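(* Let $P$ be a simple polyhedron, $\mathcal{B}$ a $P$-building set, and $\mathcal{K}_P\mathcal{B}$ a $P$-nestohedron of $\mathcal{B}$. Then every facet of $\mathcal{K}_P\mathcal{B}$ is combinatorially isomorphic to the product of an $F$-nestohedron, where $F$ is some face of $P$, and a simplex-nestohedron.
   Context: A polyhedron is an intersection of finitely many closed halfspaces; it is simple if every nonempty codimension-$k$ face is contained in exactly $k$ facets. For a simple polyhedron $P$ with facets $\{F_s\mid s\in\mathcal{S}\}$, the dual simplicial complex $\Delta(P)$ is the set of $I\subseteq\mathcal{S}$ with $\bigcap_{s\in I}F_s\neq\emptyset$. (A face $F$ of $P$ is itself a simple polyhedron, considered full-dimensional in its affine span.) A $P$-building set is a set $\mathcal{B}$ of nonempty faces of $\Delta=\Delta(P)$ such that $\{s\}\in\mathcal{B}$ for every $s\in\mathcal{S}$, and whenever $S_1,S_2\in\mathcal{B}$, $S_1\cap S_2\neq\emptyset$ and $S_1\cup S_2\in\Delta$, then $S_1\cup S_2\in\mathcal{B}$. A subset $N\subseteq\mathcal{B}$ is nested if for any pairwise incomparable $x_1,\dots,x_t\in N$, $t\ge2$, the union $x_1\cup\cdots\cup x_t$ is in $\Delta$ and not in $\mathcal{B}$. A $P$-nestohedron of $\mathcal{B}$ is a simple polyhedron whose dual simplicial complex is isomorphic to the simplicial complex of nested subsets of $\mathcal{B}$. A simplex-nestohedron is a $D$-nestohedron (of some $D$-building set) where $D$ is a simplex; an $F$-nestohedron is an $F$-nestohedron of some $F$-building set. A single point is a $0$-dimensional simplex whose dual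 simplicial complex is $\{\emptyset\}$, and its nestohedron is a point. Two polyhedra are combinatorially isomorphic if there is an isomorphism of their face lattices preserving dimension of faces. *)

(* Defs.v *)
From HB Require Import structures.
From mathcomp Require Import all_boot all_order all_algebra.
From mathcomp Require Import boolp classical_sets functions cardinality.

Set Implicit Arguments.
Unset Strict Implicit.
Unset Printing Implicit Defensive.

Import Order.TTheory GRing.Theory Num.Theory.

Local Open Scope classical_set_scope.
Local Open Scope card_scope.
Local Open Scope ring_scope.

(** Simplicial complexes are sets of simplices [D : set (set V)].  The
    vertices are the [v] such that [[set v]] is a simplex, so [V] may contain
    points which are not vertices. *)
Section Complexes.

Definition vertices (V : Type) (D : set (set V)) : set V :=
  [set v | D [set v]].

Definition complex_iso (V W : Type) (D : set (set V)) (E : set (set W)) : Prop :=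
  exists f : V -> W, set_bij (vertices D) (vertices E) f /\
    forall I : set V, I `<=` vertices D -> (D I <-> E (f @` I)).

Definition building_set (V : Type) (D : set (set V)) (B : set (set V)) : Prop :=
  [/\ B `<=` D,
      ~ B set0,
      forall s, vertices D s -> B [set s]
    & forall X Y, B X -> B Y -> X `&` Y !=set0 -> D (X `|` Y) -> B (X `|` Y)].

Definition nested_complex (V : Type) (D : set (set V)) (B : set (set V)) :
    set (set (set V)) :=
  [set N | N `<=` B /\
    forall (t : nat) (x : 'I_t -> set V), (2 <= t)%N ->
      (forall i, N (x i)) ->
      (forall i j, i != j -> ~ (x i `<=` x j)) ->
      D (\bigcup_i x i) /\ ~ B (\bigcup_i x i)].

End Complexes.

(** Polyhedra are sets of row vectors; they are not assumed to be
    full-dimensional, and every notion below is relative to the affine span.  A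
    face of a polyhedron is thus a polyhedron in the same ambient space. *)
Section Polyhedra.
Variable R : realFieldType.

Definition halfspace (n : nat) (a : 'cV[R]_n) (b : R) : set 'rV[R]_n :=
  [set x | (x *m a) 0 0 <= b].

Definition polyhedron (n : nat) (P : set 'rV[R]_n) : Prop :=
  exists (m : nat) (a : 'I_m -> 'cV[R]_n) (b : 'I_m -> R),
    (forall i, a i != 0) /\ P = \bigcap_i halfspace (a i) (b i).

(** [a = 0] is allowed, so that [P] and [set0] are faces of [P]. *)
Definition face (n : nat) (P F : set 'rV[R]_n) : Prop :=
  exists (a : 'cV[R]_n) (b : R),
    P `<=` halfspace a b /\ F = P `&` [set x | (x *m a) 0 0 = b].

Definition aff_indep (n k : nat) (v : 'I_k -> 'rV[R]_n) : Prop :=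
  forall l : 'I_k -> R,
    \sum_i l i = 0 -> \sum_i l i *: v i = 0 -> forall i, l i = 0.

(** Dimension of the affine span of [A]: one less than the largest number of
    affinely independent points of [A] (at most [n.+1] of them can be affinely
    independent).  In particular [affdim set0 = -1]. *)
Definition affdim (n : nat) (A : set 'rV[R]_n) : int :=
  (\max_(k < n.+2 |
     `[< exists v : 'I_k -> 'rV[R]_n, aff_indep v /\ forall i, A (v i) >]) k)%N%:Z
  - 1.

(** The empty face of a point has codimension 1 but is not a facet. *)
Definition facet (n : nat) (P F : set 'rV[R]_n) : Prop :=
  [/\ face P F, F !=set0 & affdim P = affdim F + 1].

Definition simple_polyhedron (n : nat) (P : set 'rV[R]_n) : Prop :=
  polyhedron P /\
  forall (F : set 'rV[R]_n) (k : nat), face P F -> F !=set0 ->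
    affdim P = affdim F + k%:Z -> [set G | facet P G /\ F `<=` G] #= `I_k.

(** The facets of [P] are indexed by themselves.  The intersection of the empty
    family of facets is [P]. *)
Definition dual_complex (n : nat) (P : set 'rV[R]_n) :
    set (set (set 'rV[R]_n)) :=
  [set I | I `<=` facet P /\ (P `&` \bigcap_(F in I) F) !=set0].

(** [K] may live in another ambient space than [P]. *)
Definition nestohedron (n : nat) (P : set 'rV[R]_n)
    (B : set (set (set 'rV[R]_n))) (m : nat) (K : set 'rV[R]_m) : Prop :=
  simple_polyhedron K /\
  complex_iso (dual_complex K) (nested_complex (dual_complex P) B).

Definition simplex (n : nat) (D : set 'rV[R]_n) : Prop :=
  exists (d : nat) (v : 'I_d.+1 -> 'rV[R]_n), aff_indep v /\
    D = [set x | exists l : 'I_d.+1 -> R,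
           [/\ forall i, 0 <= l i, \sum_i l i = 1 & x = \sum_i l i *: v i]].

Definition is_point (n : nat) (A : set 'rV[R]_n) : Prop :=
  exists x, A = [set x].

(** The last clause excludes lines, planes, etc., whose dual complex is also
    [[set set0]], as nestohedra of a point. *)
Definition simplex_nestohedron (m : nat) (K : set 'rV[R]_m) : Prop :=
  exists (n : nat) (D : set 'rV[R]_n) (B : set (set (set 'rV[R]_n))),
    [/\ simplex D,
        building_set (dual_complex D) B,
        nestohedron D B K
      & is_point D -> is_point K].

Definition face_nestohedron (n : nat) (F : set 'rV[R]_n)
    (m : nat) (K : set 'rV[R]_m) : Prop :=
  exists B : set (set (set 'rV[R]_n)),
    building_set (dual_complex F) B /\ nestohedron F B K.

Definition polyhedron_prod (m1 m2 : nat)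
    (K1 : set 'rV[R]_m1) (K2 : set 'rV[R]_m2) : set 'rV[R]_(m1 + m2) :=
  [set z | K1 (lsubmx z) /\ K2 (rsubmx z)].

(** An isomorphism of the face lattices, both ordered by inclusion. *)
Definition comb_iso (n m : nat) (P : set 'rV[R]_n) (Q : set 'rV[R]_m) : Prop :=
  exists f : set 'rV[R]_n -> set 'rV[R]_m,
    [/\ set_bij (face P) (face Q) f,
        forall F G, face P F -> face P G -> (F `<=` G <-> f F `<=` f G)
      & forall F, face P F -> affdim (f F) = affdim F].

End Polyhedra.

(* Main.v *)
(** The facet [G] of the nestohedron [K] corresponds to an element [S] of the
    building set [B], and [F] is the face of [P] cut out by the facets in [S].
    The dual complex of [G] is the link of [S] in the nested complex of [B].  An
    element of this link is either properly contained in [S], or contains [S],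
      or
    is disjoint from [S]; sending [T] to [T] in the first case and to [T `\` S]
    in the other two identifies the link with the join of the nested complex of
    [B] restricted to the boundary of the simplex [S] and of the nested complex
      of
    the contraction of [B] by [S], a building set of the link of [S], that is of
    the dual complex of [F].

    No nestohedron has to be constructed: a face of [G] cut out by a maximal
    simplex of one factor of the join has the other factor as its dual complex.
    This gives [K1] and [K2], up to the lineality space of [G], which both faces
    contain and which is divided out of [K2].  Finally, in a simple polyhedron
      the
    nonempty faces correspond to the simplices of the dual complex, with the
    codimension equal to the number of vertices, so that the isomorphism of [G]
    and [K1 x K2] can be read off the dual complexes.

    The facts on simple polyhedra come from coordinates in which the polyhedron
    is [{u | u c_i <= 1 for all i}] without redundant constraint: its nonempty
      faces
    are given by the sets of constraints active at a point, and it is simple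
    exactly when each of these sets of columns is linearly independent. *)
Require Import Defs.
From mathcomp Require Import all_boot all_order all_algebra finmap.
From mathcomp Require Import boolp classical_sets functions cardinality reals.
From mathcomp Require Import lra.
Set Implicit Arguments.
Unset Strict Implicit.
Unset Printing Implicit Defensive.

Import Order.TTheory GRing.Theory Num.Theory.

Local Open Scope classical_set_scope.
Local Open Scope card_scope.
Local Open Scope ring_scope.

(** * Affine dimension *)

Section AffineDimension.
Variable R : realFieldType.

(** The set [A] contains [x], and the rows of [W] span the direction of its
    affine hull. *)
Definition directed (n p : nat) (A : set 'rV[R]_n) (x : 'rV[R]_n)
    (W : 'M[R]_(p, n)) :=
  [/\ A x, forall y, A y -> (y - x <= W)%MS
    & forall j, exists2 e, e != 0 & A (x + e *: row j W)].

Lemma affdim_set0 (n : nat) : affdim (set0 : set 'rV[R]_n) = -1.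
Proof.
rewrite /affdim big1 // => k /asboolP [v [_ v0]].
by case: (posnP k) => // k_gt0; have := v0 (Ordinal k_gt0).
Qed.

(** In homogeneous coordinates based at [x], affinely independent points of [A] become linearly
    independent rows, and these lie in the row space of [diag(1, W)], of rank [\rank W + 1].
    Conversely [x] and suitable points [x + e *: row j W] reach that number. *)
Lemma affdim_directed (n p : nat) (A : set 'rV[R]_n) x (W : 'M[R]_(p, n)) :
  directed A x W -> affdim A = (\rank W)%:Z.
Proof.
move=> [Ax AW WA]; rewrite /affdim.
suff -> : (\max_(k < n.+2 | `[< exists v : 'I_k -> 'rV[R]_n,
    aff_indep v /\ forall i, A (v i) >]) k)%N = (\rank W).+1.
  by rewrite -addn1 PoszD addrK.
have rk_le : ((\rank W).+1 < n.+2)%N by rewrite !ltnS rank_leq_col.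
apply/eqP; rewrite eqn_leq; apply/andP; split.
  apply/bigmax_leqP => k /asboolP [v [v_free Av]].
  pose N : 'M[R]_(k, 1 + n) := row_mx (const_mx 1) (\matrix_i (v i - x)).
  have N_free : row_free N.
    apply: inj_row_free => l lN0; apply/rowP => i; rewrite mxE.
    have [l0 lv0] : \sum_i l 0 i = 0 /\ \sum_i l 0 i *: (v i - x) = 0.
      move: lN0; rewrite mul_mx_row -(row_mx0 R 1 1 n) => /eq_row_mx [].
      move=> /matrixP /(_ 0 0); rewrite !mxE => l0.
      rewrite mulmx_sum_row => lv0; split.
        by rewrite -[RHS]l0; apply: eq_bigr => j _; rewrite !mxE mulr1.
      by rewrite -[RHS]lv0; apply: eq_bigr => j _; rewrite rowK.
    have {}v_free := v_free (fun j => l 0 j) l0.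
    refine (v_free _ i).
    rewrite -[LHS]subr0 -[X in _ - X](scale0r x) -l0 scaler_suml -sumrB.
    by apply: etrans lv0; apply: eq_bigr => j _; rewrite scalerBr.
  rewrite -(eqP N_free).
  have <- : \rank (block_mx (1%:M : 'M[R]_1) 0 0 W) = (\rank W).+1.
    by rewrite rank_diag_block_mx mxrank1 add1n.
  apply: mxrankS.
  apply/row_subP => i; rewrite row_row_mx row_const rowK.
  have [u vE] := submxP (AW _ (Av i)).
  apply/submxP; exists (row_mx 1 u).
  rewrite mul_row_block !mulmx0 addr0 add0r mulmx1 -vE; congr row_mx.
  by apply/rowP => j; rewrite ord1 !mxE.
apply: (@leq_bigmax_cond _ _ (fun k : 'I_n.+2 => k : nat) (Ordinal rk_le)).
apply/asboolP.
have /choice [e he] j : exists e, e != 0 /\ A (x + e *: row j W).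
  by have [e] := WA j; exists e.
(* [f] selects a basis among the rows of [W]; the index [ord0] is reserved for the base point
   [x]. *)
pose f := maxrankfun W.
pose v (i : 'I_(\rank W).+1) :=
  if unlift ord0 i is Some j then x + e (f j) *: row (f j) W else x.
exists v; split; last first.
  by move=> i; rewrite /v; case: unliftP => // j _; case: (he (f j)).
move=> l l0; rewrite big_ord_recl /v unlift_none.
under eq_bigr do rewrite liftK scalerDr.
rewrite big_split /= -scaler_suml addrA -scalerDl.
move: (l0); rewrite big_ord_recl => ->; rewrite scale0r add0r => lW.
have l1 (j : 'I_(\rank W)) : l (lift ord0 j) = 0.
  pose u : 'rV[R]_(\rank W) := \row_j (l (lift ord0 j) * e (f j)).
  have /eqP : u *m rowsub f W = 0.
    rewrite mulmx_sum_row -[RHS]lW; apply: eq_bigr => i _.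
    by rewrite mxE scalerA; congr (_ *: _); apply/rowP => q; rewrite !mxE.
  rewrite mulmx_free_eq0 ?maxrowsub_free // => /eqP/rowP /(_ j).
  rewrite !mxE => /eqP; rewrite mulf_eq0 => /orP [/eqP //|].
  by case: (he (f j)) => /negbTE ->.
move=> i; case: (unliftP ord0 i) => [j -> //|->].
by move: l0; rewrite big_ord_recl big1 ?addr0.
Qed.

Lemma directed_prod (n1 n2 p1 p2 : nat) (A1 : set 'rV[R]_n1)
    (A2 : set 'rV[R]_n2) x1 x2 (W1 : 'M[R]_(p1, n1)) (W2 : 'M[R]_(p2, n2)) :
  directed A1 x1 W1 -> directed A2 x2 W2 ->
  directed (polyhedron_prod A1 A2) (row_mx x1 x2) (block_mx W1 0 0 W2).
Proof.
move=> [Ax1 AW1 WA1] [Ax2 AW2 WA2]; split.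
- by rewrite /polyhedron_prod /= row_mxKl row_mxKr.
- move=> y [/AW1/submxP[u1 E1] /AW2/submxP[u2 E2]].
  apply/submxP; exists (row_mx u1 u2).
  rewrite mul_row_block !mulmx0 addr0 add0r -E1 -E2.
  by rewrite -[in LHS](hsubmxK y) opp_row_mx add_row_mx.
- move=> j; case: (split_ordP j) => i ->.
    have [e e0 Ae] := WA1 i; exists e => //.
    rewrite block_mxEv rowKu row_row_mx row0 scale_row_mx add_row_mx.
    by rewrite scaler0 addr0 /polyhedron_prod /= row_mxKl row_mxKr.
  have [e e0 Ae] := WA2 i; exists e => //.
  rewrite block_mxEv rowKd row_row_mx row0 scale_row_mx add_row_mx.
  by rewrite scaler0 addr0 /polyhedron_prod /= row_mxKl row_mxKr.
Qed.

End AffineDimension.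

(** * Faces and active constraints *)

Section Presentation.
Variable R : realFieldType.

Definition hpoly (n m : nat) (a : 'M[R]_(n, m)) (b : 'I_m -> R) :
    set 'rV[R]_n :=
  [set x | forall i, (x *m a) 0 i <= b i].

Definition active (n m : nat) (a : 'M[R]_(n, m)) (b : 'I_m -> R)
    (x : 'rV[R]_n) : {set 'I_m} :=
  [set i | (x *m a) 0 i == b i]%SET.

(** Multiplying by this projection on the right zeroes the columns outside [I] without changing the
    shape, so column subfamilies for different [I] stay comparable. *)
Definition coordproj (m : nat) (I : {set 'I_m}) : 'M[R]_m :=
  diag_mx (\row_j (j \in I)%:R).

Lemma mulmx_coordproj p m (A : 'M[R]_(p, m)) I i j :
  (A *m coordproj I) i j = A i j * (j \in I)%:R.
Proof. by rewrite mul_mx_diag !mxE. Qed.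

Lemma mulmx_coordproj_eq0 m (v : 'rV[R]_m) (I : {set 'I_m}) :
  v *m coordproj I = 0 <-> forall i, i \in I -> v 0 i = 0.
Proof.
split=> [/rowP vI0 i iI|vI0].
  by have := vI0 i; rewrite mulmx_coordproj iI mulr1 mxE.
apply/rowP => i; rewrite mulmx_coordproj mxE.
by have [/vI0 ->|_] := boolP (i \in I); rewrite ?mul0r ?mulr0.
Qed.

Lemma rank_coordproj m (I : {set 'I_m}) : (\rank (coordproj I) <= #|I|)%N.
Proof.
have -> : coordproj I = \sum_(j in I) delta_mx j j.
  apply/matrixP => i j; rewrite !mxE summxE.
  under eq_bigr do rewrite mxE.
  have [->|nij] := eqVneq i j; last first.
    rewrite mulr0n big1 // => q _; case: eqP => //= <-; rewrite eq_sym.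
    by rewrite (negbTE nij).
  rewrite mulr1n; have [jI|jI] := boolP (j \in I).
    rewrite (bigD1 j) //= !eqxx big1 ?addr0 // => q /andP[_].
    by rewrite eq_sym => /negbTE ->.
  by rewrite big1 // => q qI; case: eqP => // jq; rewrite jq qI in jI.
rewrite -sum1_card; elim/big_rec2: _ => [|j s M _ le_s];
  first by rewrite mxrank0.
apply: leq_trans (mxrank_add _ _) _.
by rewrite leq_add // mxrank_delta.
Qed.

(** The columns of [a] indexed by [I] are linearly independent exactly when this
    rank is [#|I|]. *)
Definition crank (n m : nat) (a : 'M[R]_(n, m)) (I : {set 'I_m}) : nat :=
  \rank (a *m coordproj I).

(** When the rank is [#|I|], the row space of [a *m coordproj I] fills that of [coordproj I], so
    every choice of values on [I] is attained. *)
Lemma crank_surj n m (a : 'M[R]_(n, m)) (I : {set 'I_m}) (t : 'I_m -> R) :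
  crank a I = #|I| -> exists v : 'rV_n, forall i, i \in I -> (v *m a) 0 i = t i.
Proof.
move=> rI; have sI : (a *m coordproj I <= coordproj I)%MS by apply: submxMl.
have eI : (coordproj I <= a *m coordproj I)%MS.
  rewrite -(geq_leqif (mxrank_leqif_sup sI)).
  by move: rI; rewrite /crank => ->; exact: rank_coordproj.
have /submxP [v vE] := submx_trans (submxMl (\row_j t j) (coordproj I)) eI.
exists v => i iI; move/rowP: vE => /(_ i).
by rewrite mulmxA !mulmx_coordproj iI !mulr1 mxE => <-.
Qed.

Lemma small_step m (s t : 'I_m -> R) (I : {set 'I_m}) :
  (forall i, i \in I -> 0 < s i) ->
  exists2 e, 0 < e & forall i, i \in I -> e * t i < s i.
Proof.
(* [N] bounds every ratio [t i / s i], so [(N + 1)^-1] is a small enough step for all [i] at once;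
   the [+ 1] covers [N = 0] and makes the inequality strict. *)
move=> s_gt0; pose N := \sum_(i in I) `|t i| / s i.
have t_ge0 i : i \in I -> 0 <= `|t i| / s i.
  by move=> iI; rewrite divr_ge0 // ltW // s_gt0.
have N_ge0 : 0 <= N by rewrite sumr_ge0.
exists (N + 1)^-1 => [|i iI]; first by rewrite invr_gt0 ltr_wpDl.
rewrite mulrC ltr_pdivrMr ?ltr_wpDl // mulrC -ltr_pdivrMr ?s_gt0 //.
rewrite (@le_lt_trans _ _ N) ?ltrDl // /N (bigD1 i) //=.
rewrite ler_wpDr ?sumr_ge0 // => [j /andP[jI _]|]; first exact: t_ge0.
by rewrite ler_pM2r ?invr_gt0 ?s_gt0 // ler_norm.
Qed.

(** Inactive constraints have positive slack, hence room for a small step; an active one either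
    decreases along [v] and becomes inactive, or is constant and stays active. *)
Lemma hpoly_step n m (a : 'M[R]_(n, m)) b (x v : 'rV[R]_n) :
  hpoly a b x -> (forall i, i \in active a b x -> (v *m a) 0 i <= 0) ->
  exists e, [/\ 0 < e, hpoly a b (x + e *: v) &
    active a b (x + e *: v) =
      [set i in active a b x | (v *m a) 0 i == 0]%SET].
Proof.
move=> Px v_le0.
have s_gt0 i : i \in ~: active a b x -> 0 < b i - (x *m a) 0 i.
  by rewrite !inE subr_gt0 lt_neqAle => ->; exact: Px.
have [e e0 he] := small_step (fun i => (v *m a) 0 i) s_gt0.
have E i : ((x + e *: v) *m a) 0 i = (x *m a) 0 i + e * (v *m a) 0 i.
  by rewrite mulmxDl -scalemxAl mxE [X in _ + X]mxE.
exists e; split=> //.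
  move=> i; rewrite E; have [iI|iI] := boolP (i \in active a b x).
    move: (iI); rewrite inE => /eqP ->; rewrite -[leRHS]addr0 lerD2l.
    by rewrite pmulr_rle0 // v_le0.
  have := he i; rewrite finset.in_setC iI => /(_ isT); rewrite ltrBrDl.
  exact: ltW.
apply/setP => i; rewrite !inE E.
have [iI|iI] := boolP (i \in active a b x).
  move: (iI); rewrite inE => /eqP ->; rewrite eqxx /= -subr_eq0 addrAC subrr.
  by rewrite add0r mulf_eq0 (gt_eqF e0).
have := he i; rewrite finset.in_setC iI => /(_ isT);
  rewrite ltrBrDl => /lt_eqF ->.
by move: iI; rewrite inE => /negbTE ->.
Qed.

(** A point of a convex set at which the fewest constraints are active plays the
    role of a point of its relative interior. *)
Lemma hpoly_min n m (a : 'M[R]_(n, m)) b (C : set 'rV[R]_n) :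
  C `<=` hpoly a b -> C !=set0 ->
  (forall x y, C x -> C y -> C (2^-1 *: (x + y))) ->
  exists2 x, C x & forall y, C y -> active a b x \subset active a b y.
Proof.
move=> CP [x1 Cx1] Cmid.
have ex : exists k, `[< exists2 x, C x & #|active a b x| = k >].
  by exists #|active a b x1|; apply/asboolP; exists x1.
case: (ex_minnP ex) => k /asboolP [x Cx xk] kmin; exists x => // y Cy.
(* A constraint is tight at the midpoint only if it is tight at both ends, so minimality of [x]
   forces its active set into that of [y]. *)
pose z := 2^-1 *: (x + y).
have zE i : (z *m a) 0 i = 2^-1 * ((x *m a) 0 i + (y *m a) 0 i).
  by rewrite -scalemxAl mulmxDl !mxE.
have zI : active a b z \subset active a b x :&: active a b y.
  apply/fintype.subsetP => i; rewrite !inE zE.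
  have := CP _ Cx i; have := CP _ Cy i => h1 h2 /eqP h3.
  by apply/andP; split; apply/eqP; lra.
apply: (@fintype.subset_trans _ _ (active a b x :&: active a b y));
  last exact: finset.subsetIr.
rewrite (_ : _ :&: _ = active a b x) //.
apply/eqP; rewrite eqEcard finset.subsetIl /= xk.
apply: leq_trans (subset_leq_card zI).
by apply: kmin; apply/asboolP; exists z => //; exact: Cmid.
Qed.

End Presentation.
Arguments coordproj {R m} I.

(** * Faces of an irredundantly presented polyhedron *)

Section PresentedFaces.
Variable R : realFieldType.

(** The witness [w] is a point where constraint [i] alone is active, that is, a point in the
    relative interior of the [i]-th facet. This excludes zero columns and repeated columns. *)
Definition irredundant r k (c : 'M[R]_(r, k)) : Prop :=
  forall i, exists2 w : 'rV_r, (w *m c) 0 i = 1 &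
    forall j, j != i -> (w *m c) 0 j < 1.

Definition param r n (x0 : 'rV[R]_n) (V : 'M[R]_(r, n)) (u : 'rV[R]_r) :
  'rV[R]_n := x0 + u *m V.

Definition cell r k n (c : 'M[R]_(r, k)) (x0 : 'rV[R]_n) (V : 'M[R]_(r, n))
    (I : {set 'I_k}) : set 'rV[R]_n :=
  param x0 V @` [set u | hpoly c (fun=> 1) u /\ I \subset active c (fun=> 1) u].

(** An irredundant description of [P] in affine coordinates of its affine hull
    whose origin is in the relative interior of [P]. *)
Definition presents r k n (c : 'M[R]_(r, k)) (x0 : 'rV[R]_n) (V : 'M[R]_(r, n))
    (P : set 'rV[R]_n) : Prop :=
  [/\ row_free V, irredundant c & P = cell c x0 V finset.set0].

Section Fixed.
Variables (r k n : nat) (c : 'M[R]_(r, k)) (x0 : 'rV[R]_n) (V : 'M[R]_(r, n)).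
Variable P : set 'rV[R]_n.
Hypothesis presP : presents c x0 V P.

Local Notation Q := (hpoly c (fun=> 1)).
Local Notation act := (active c (fun=> 1)).
Local Notation phi := (param x0 V).
Local Notation cl := (cell c x0 V).

Lemma presentsE x : P x <-> exists2 u, Q u & x = phi u.
Proof.
have [_ _ ->] := presP; split=> [[u [Qu _] <-]|[u Qu ->]]; first by exists u.
by exists u; split=> //; exact: finset.sub0set.
Qed.

Lemma param_inj : injective phi.
Proof. by have [Vf _ _] := presP; move=> u v /addrI /(row_free_inj Vf). Qed.

Lemma cell_param (I : {set 'I_k}) u : cl I (phi u) <-> Q u /\ I \subset act u.
Proof.
by split=> [[v vI /param_inj <-]|uI] //; exists u.
Qed.

Lemma cell_subP (I : {set 'I_k}) : cl I `<=` P.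
Proof. by move=> _ [u [Qu _] <-]; apply/presentsE; exists u. Qed.

Lemma cell_sub u (J : {set 'I_k}) :
  Q u -> cl (act u) `<=` cl J <-> J \subset act u.
Proof.
move=> Qu; split=> [uJ|Ju];
  first by have [] := (cell_param J u).1 (uJ _ ((cell_param _ _).2 (conj Qu
    (subxx _)))).
move=> _ [v [Qv uv] <-]; apply/cell_param; split=> //.
exact: fintype.subset_trans uv.
Qed.

(** The supporting hyperplane is the sum of the constraints in [I]: its slack is a sum of
    nonnegative slacks and vanishes only when each of them does. The matrix [pinvmx V] carries the
    linear form back to the ambient space. *)
Lemma cell_face (I : {set 'I_k}) : face P (cl I).
Proof.
have [Vf _ _] := presP.
pose a : 'cV[R]_n := pinvmx V *m \sum_(i in I) col i c.
pose b : R := #|I|%:R + (x0 *m a) 0 0.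
have slackE u : b - (phi u *m a) 0 0 = \sum_(i in I) (1 - (u *m c) 0 i).
  rewrite /b /param mulmxDl [X in _ - X]mxE opprD addrA addrK sumrB sumr_const.
  congr (_ - _); rewrite mulmxA -(mulmxA u) mulmxVp // mulmx1 mulmx_sumr.
  by rewrite summxE; apply: eq_bigr => i _; rewrite !mxE;
    apply: eq_bigr => j _; rewrite mxE.
have ge0 u : Q u -> forall i, i \in I -> 0 <= 1 - (u *m c) 0 i.
  by move=> Qu i _; rewrite subr_ge0.
exists a, b; split.
  move=> _ /presentsE [u Qu ->]; rewrite /halfspace /= -subr_ge0 slackE.
  exact: sumr_ge0 (ge0 u Qu).
apply/seteqP; split=> [x Ix|x [/presentsE [u Qu ->]]] /=.
  split; first exact: cell_subP Ix.
  case: Ix => u [Qu /fintype.subsetP Iu] <-; apply/esym/eqP;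
    rewrite -subr_eq0 slackE.
  by rewrite big1 // => i /Iu; rewrite inE => /eqP ->; rewrite subrr.
move=> /esym /eqP; rewrite -subr_eq0 slackE psumr_eq0; last exact: ge0.
move=> /allP h; apply/cell_param; split=> //; apply/fintype.subsetP => i iI.
have := h i (mem_index_enum _); rewrite iI /= subr_eq0 eq_sym => e.
by rewrite inE.
Qed.

(** A point [u] of [E] with the fewest active constraints determines [E]. For [v] in the cell of
    [act u], the segment from [v] to [u] extends beyond [u] inside the cell of [J]; a linear form
    that is maximal at [u] must be constant along it, so [v] is in [E]. *)
Lemma face_of_cell (J : {set 'I_k}) E :
  face (cl J) E -> E !=set0 -> exists2 u, Q u & E = cl (act u).
Proof.
move=> [a [b [Jab EJ]]] [x Ex].
pose C := [set u | Q u /\ E (phi u)].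
have phiE (u : 'rV_r) : (phi u *m a) 0 0 = (x0 *m a) 0 0 + (u *m (V *m a)) 0 0.
  by rewrite /param mulmxDl mxE mulmxA.
have Eabs u : E (phi u) <-> cl J (phi u) /\ (phi u *m a) 0 0 = b by rewrite EJ.
have [|||u [Qu Eu] umin] := @hpoly_min _ _ _ c (fun=> 1) C.
- by move=> u [].
- have [u [Qu _] xE] : cl J x by move: Ex; rewrite EJ => -[].
  by exists u; rewrite /C /= xE.
- move=> u v [Qu Eu] [Qv Ev].
  have Qz : Q (2^-1 *: (u + v)).
    move=> i; rewrite -scalemxAl mulmxDl !mxE.
    by have := Qu i; have := Qv i; rewrite ?mxE; lra.
  split=> //; move: Eu Ev => /Eabs [/cell_param [_ Ju] eu] /Eabs [/cell_param
    [_ Jv] ev].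
  apply/Eabs; split; last first.
    by move: eu ev; rewrite !phiE -scalemxAl mulmxDl !mxE; lra.
  apply/cell_param; split=> //; apply/fintype.subsetP => i iJ.
  move: (fintype.subsetP Ju _ iJ) (fintype.subsetP Jv _ iJ); rewrite !inE.
  by rewrite -scalemxAl mulmxDl !mxE => /eqP -> /eqP ->; apply/eqP; lra.
have /Eabs [/cell_param [_ Ju] uab] := Eu.
exists u => //; apply/seteqP; split=> y.
  move=> Ey; have [v [Qv _] yE] : cl J y by move: Ey; rewrite EJ => -[].
  rewrite -yE; apply/cell_param; split=> //.
  by apply: umin; split=> //; rewrite yE.
move=> [v [Qv uv] <-]; have Jv : cl J (phi v).
  by apply/cell_param; split=> //; exact: fintype.subset_trans uv.
apply/Eabs; split=> //.
(* The step leads from [u] a little further away from [v]. Constraints active at [u] are active at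
   [v] too, so they do not move. *)
have [|e [e0 Qe actE]] := @hpoly_step _ _ _ c (fun=> 1) u (u - v) Qu.
  move=> i iu; move: (fintype.subsetP uv _ iu) (iu);
    rewrite !inE => /eqP e1 /eqP e2.
  by rewrite mulmxBl mxE [X in _ + X]mxE e1 e2 subrr.
have Je : cl J (phi (u + e *: (u - v))).
  apply/cell_param; split=> //; rewrite actE.
  apply/fintype.subsetP => i iJ; have iu := fintype.subsetP Ju _ iJ.
  rewrite inE iu /= mulmxBl mxE [X in _ + X]mxE.
  by move: (fintype.subsetP uv _ iu) (iu); rewrite !inE => /eqP -> /eqP ->;
    rewrite subrr.
move: (Jab _ Je) (Jab _ Jv); rewrite /halfspace /=.
have gE : ((u + e *: (u - v)) *m (V *m a)) 0 0 =
    (u *m (V *m a)) 0 0 + e * ((u *m (V *m a)) 0 0 - (v *m (V *m a)) 0 0).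
  rewrite mulmxDl -scalemxAl mulmxBl.
  by move: (u *m _) (v *m _) => s t; rewrite !mxE.
move: uab; rewrite !phiE gE.
set s := (u *m _) 0 0; set t := (v *m _) 0 0 => <- h1 h2.
apply/eqP; rewrite eq_le h2 /= lerD2l -subr_le0 -(pmulr_rle0 _ e0).
by move: h1; rewrite lerD2l gerDl.
Qed.

Lemma face_cell E :
  face P E -> E !=set0 -> exists2 u, Q u & E = cl (act u).
Proof. by have [_ _ ->] := presP; exact: face_of_cell. Qed.

(** The direction of a face is the space of vectors killed by the active columns: small steps along
    such a vector keep every active constraint tight. *)
Lemma directed_cell u : Q u ->
  directed (cl (act u)) (phi u) (kermx (c *m coordproj (act u)) *m V).
Proof.
move=> Qu; have kerP (v : 'rV_r) :
    (v <= kermx (c *m coordproj (act u)))%MS <->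
    forall i, i \in act u -> (v *m c) 0 i = 0.
  rewrite -mulmx_coordproj_eq0 -mulmxA; split=> [/sub_kermxP //|h].
  exact/sub_kermxP.
split.
- by apply/cell_param.
- move=> _ [v [Qv uv] <-].
  rewrite /param opprD addrACA subrr add0r -mulmxBl; apply: submxMr.
  apply/kerP => i iu; move: (fintype.subsetP uv _ iu) (iu); rewrite !inE.
  by move=> /eqP e1 /eqP e2; rewrite mulmxBl mxE [X in _ + X]mxE e1 e2 subrr.
- move=> j; have /kerP K0 := row_sub j (kermx (c *m coordproj (act u))).
  have [|e [e0 Qe actE]] := @hpoly_step _ _ _ c (fun=> 1) u
    (row j (kermx (c *m coordproj (act u)))) Qu.
    by move=> i /K0 ->.
  exists e; first by rewrite gt_eqF.
  rewrite row_mul scalemxAl -addrA -mulmxDl; apply/cell_param; split=> //.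
  by rewrite actE; apply/fintype.subsetP => i iu; rewrite inE iu K0 /=.
Qed.

Lemma affdim_cell u : Q u -> affdim (cl (act u)) + (crank c (act u))%:Z = r%:Z.
Proof.
move=> Qu; rewrite (affdim_directed (directed_cell Qu)).
have [Vf _ _] := presP.
by rewrite mxrankMfree // mxrank_ker -PoszD subnK // rank_leq_row.
Qed.

Lemma active0 : act 0 = finset.set0.
Proof.
by apply/setP => i; rewrite !inE mul0mx mxE eq_sym oner_eq0.
Qed.

Lemma Q0 : Q 0. Proof. by move=> i; rewrite mul0mx mxE ler01. Qed.

Lemma affdim_presented : affdim P = r%:Z.
Proof.
have [_ _ ->] := presP; rewrite -(affdim_cell Q0) active0 /crank.
suff -> : (coordproj finset.set0 : 'M[R]_k) = 0 by rewrite mulmx0 mxrank0 addr0.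
apply/eqP; rewrite -mxrank_eq0 -leqn0.
by apply: leq_trans (rank_coordproj _ _) _; rewrite cards0.
Qed.

Lemma irredundant_active i : exists2 w, Q w & act w = [set i]%SET.
Proof.
have [_ /(_ i) [w wi wj] _] := presP; exists w.
  by move=> j; have [->|/wj /ltW //] := eqVneq j i; rewrite wi.
apply/setP => j; rewrite !inE; have [->|ji] := eqVneq j i;
  first by rewrite wi eqxx.
by rewrite lt_eqF // wj.
Qed.

Lemma crank1 i : crank c [set i]%SET = 1%N.
Proof.
have [_ /(_ i) [w wi _] _] := presP; apply/eqP; rewrite eqn_leq.
rewrite (leq_trans (mxrankM_maxr _ _)) ?(leq_trans (rank_coordproj _ _))
  ?cards1 //.
rewrite lt0n mxrank_eq0; apply/eqP => c0.
have := mulmx_coordproj (w *m c) [set i]%SET 0 i.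
by rewrite -mulmxA c0 mulmx0 mxE wi inE eqxx mulr1 => /eqP;
  rewrite eq_sym oner_eq0.
Qed.

(** A matrix of rank one is a column times a row, so all active columns are proportional. They take
    the same value 1 at [u], hence two of them would be equal, while irredundancy separates distinct
    constraints. *)
Lemma crank1_active u : crank c (act u) = 1%N -> exists i, act u = [set i]%SET.
Proof.
rewrite /crank; set M := c *m _ => rk1.
have [A0|[i iu]] := finset.set_0Vmem (act u).
  suff M0 : M = 0 by rewrite M0 mxrank0 in rk1.
  by apply/matrixP => i j; rewrite mulmx_coordproj A0 inE mulr0 mxE.
exists i; apply/eqP; rewrite finset.eqEsubset finset.sub1set iu andbT.
apply/fintype.subsetP => j ju; rewrite inE; apply/negPn/negP => ji.
have [x [y xy]] : exists (x : 'cV_r) (y : 'rV_k), M = x *m y.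
  by move: (col_base M) (row_base M) (mulmx_base M); rewrite rk1 => x y <-;
    exists x, y.
have ME (v : 'rV_r) q : q \in act u -> (v *m x) 0 0 * y 0 q = (v *m c) 0 q.
  move=> qu; have := mulmx_coordproj (v *m c) (act u) 0 q.
  rewrite -mulmxA -/M xy mulmxA mxE big_ord1 qu mulr1 => <-.
  by [].
have [_ /(_ i) [w wi /(_ j ji) wj] _] := presP.
have := ME u i iu; have := ME u j ju; have := ME w i iu; have := ME w j ju.
move: (iu) (ju); rewrite !inE => /eqP -> /eqP -> w1; rewrite wi => w2 u1 u2.
have x0' : (u *m x) 0 0 != 0.
  by apply/eqP => x00; move: u1 => /eqP; rewrite x00 mul0r eq_sym oner_eq0.
have yij : y 0 j = y 0 i by apply: (mulfI x0'); rewrite u1 u2.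
by move: wj; rewrite -w1 yij w2 ltxx.
Qed.

(** The codimension of a face is the rank of its active columns, so facets are the faces of rank
    one, which have a single active constraint. *)
Lemma facet_cell E : facet P E <-> exists i, E = cl [set i]%SET.
Proof.
split=> [[fE E0 dE]|[i ->]].
  have [u Qu EE] := face_cell fE E0; move: dE.
  rewrite EE affdim_presented -(affdim_cell Qu) => /addrI [].
  by move=> /crank1_active [i ->]; exists i.
have [w Qw wi] := irredundant_active i.
split; first exact: cell_face.
  by exists (phi w); apply/cell_param; rewrite wi.
by rewrite affdim_presented -(affdim_cell Qw) wi crank1.
Qed.

Lemma cell1_inj : injective (fun i => cl [set i]%SET).
Proof.
move=> i j ij; have [w Qw wi] := irredundant_active i.
have : cl (act w) `<=` cl [set j]%SET by rewrite wi ij.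
by rewrite cell_sub // wi finset.sub1set inE => /eqP.
Qed.

Lemma cell_facets u : Q u ->
  [set G | facet P G /\ cl (act u) `<=` G] =
  (fun i => cl [set i]%SET) @` [set i | i \in act u].
Proof.
move=> Qu; apply/seteqP; split=> [G [/facet_cell [i ->]]|_ [i /= iu <-]].
  by rewrite cell_sub // finset.sub1set => iu; exists i.
split; first by apply/facet_cell; exists i.
by rewrite cell_sub // finset.sub1set.
Qed.

Lemma card_image_set (T : Type) (f : 'I_k -> T) (A : {set 'I_k}) :
  injective f -> f @` [set i | i \in A] #= `I_#|A|.
Proof.
move=> finj; apply: (@card_eq_trans _ _ _ _ [set i | i \in A]).
  by apply: inj_card_eq => i j _ _; exact: finj.
have -> : [set i | i \in A] = enum_val @` [set: 'I_#|A|].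
  apply/seteqP; split=> [i /= iA|_ [j _ <-]] /=; last exact: enum_valP.
  by exists (enum_rank_in iA i) => //; rewrite enum_rankK_in.
rewrite card_eq_sym; apply: card_eq_trans card_II _.
by rewrite card_eq_sym; apply: inj_card_eq => i j _ _; exact: enum_val_inj.
Qed.

Lemma cell_bigcap (I : {set 'I_k}) :
  P `&` \bigcap_(F in (fun i => cl [set i]%SET) @` [set i | i \in I]) F = cl I.
Proof.
apply/seteqP; split=> [x [/presentsE [u Qu ->] h]|x Ix].
  apply/cell_param; split=> //; apply/fintype.subsetP => i iI.
  have /cell_param [_] : cl [set i]%SET (phi u) by apply: h; exists i.
  by rewrite finset.sub1set.
split; first exact: cell_subP Ix.
move=> _ [i /= iI <-]; case: Ix => u [Qu Iu] <-; apply/cell_param; split=> //.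
by rewrite finset.sub1set (fintype.subsetP Iu).
Qed.

(** The face with active set [A] has codimension [crank c A] and lies in exactly [#|A|] facets;
    simplicity says that these numbers agree. *)
Lemma simple_crank :
  (forall u, Q u -> crank c (act u) = #|act u|) <->
  (forall (F : set 'rV[R]_n) (l : nat), face P F -> F !=set0 ->
    affdim P = affdim F + l%:Z -> [set G | facet P G /\ F `<=` G] #= `I_l).
Proof.
split=> [h F l fF F0|h u Qu].
  have [u Qu ->] := face_cell fF F0.
  rewrite affdim_presented -(affdim_cell Qu) => /addrI [<-].
  rewrite cell_facets // h //; exact: card_image_set cell1_inj.
have /(_ (crank c (act u))) := h _ _ (cell_face (act u)).
rewrite affdim_presented -(affdim_cell Qu) cell_facets // => H.
have {}H := H (ex_intro _ (phi u) ((cell_param _ _).2 (conj Qu (subxx _))))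
  erefl.
apply/esym/card_eq_II; apply: card_eq_trans H.
by rewrite card_eq_sym; exact: card_image_set cell1_inj.
Qed.

(** Independence of the active columns yields a direction that keeps the constraints in [I] tight
    and releases all the other active ones. *)
Lemma active_shrink u (I : {set 'I_k}) :
  crank c (act u) = #|act u| -> Q u -> I \subset act u ->
  exists2 u', Q u' & act u' = I.
Proof.
move=> rk Qu Iu.
have [v vE] := crank_surj (fun i => if i \in I then 0 else -1) rk.
have [|e [e0 Qe eE]] := @hpoly_step _ _ _ c (fun=> 1) u v Qu.
  by move=> i /vE ->; case: ifP => // _; rewrite lerN10.
exists (u + e *: v) => //; rewrite eE; apply/setP => i; rewrite inE.
have [iu|iu] := boolP (i \in act u); last first.
  by apply/esym/negbTE; apply: contra iu => /(fintype.subsetP Iu).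
by rewrite vE //=; case: ifP; rewrite ?eqxx // oppr_eq0 oner_eq0.
Qed.

End Fixed.
End PresentedFaces.

(** * Existence of an irredundant presentation *)

Section PresentationExistence.
Variable R : realFieldType.

Lemma polyhedron_hpoly n (P : set 'rV[R]_n) :
  polyhedron P -> exists m (a : 'M[R]_(n, m)) b, P = hpoly a b.
Proof.
move=> [m [a [b [_ ->]]]]; exists m, (\matrix_(p, i) a i p 0), b.
have E (x : 'rV_n) i : (x *m \matrix_(p, i) a i p 0) 0 i = (x *m a i) 0 0.
  by rewrite !mxE; apply: eq_bigr => p _; rewrite mxE.
apply/seteqP; split=> x h i; first by rewrite E; exact: h.
by move=> _; rewrite /halfspace /= -E.
Qed.

Lemma mulmx_col n m (a : 'M[R]_(n, m)) (x : 'rV[R]_n) i :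
  (x *m col i a) 0 0 = (x *m a) 0 i.
Proof. by rewrite !mxE; apply: eq_bigr => p _; rewrite mxE. Qed.

Lemma hpoly_polyhedron n m (a : 'M[R]_(n, m)) b :
  hpoly a b !=set0 -> polyhedron (hpoly a b).
Proof.
move=> [x0 Px0]; pose A := [set i | col i a != 0]%SET.
exists #|A|, (fun i => col (enum_val i) a), (fun i => b (enum_val i)); split.
  by move=> i; have := enum_valP i; rewrite inE.
apply/seteqP; split=> [x Px i _|x Px i]; rewrite /halfspace /=.
  by rewrite mulmx_col; exact: Px.
have [iA|] := boolP (i \in A).
  by have := Px (enum_rank_in iA i) I;
    rewrite /halfspace /= enum_rankK_in // mulmx_col.
rewrite inE negbK => /eqP ai; have := Px0 i.
by rewrite -(mulmx_col a x) -(mulmx_col a x0) ai !mulmx0.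
Qed.

Lemma polyhedron_cap n (P : set 'rV[R]_n) a b :
  polyhedron P -> (P `&` halfspace a b) !=set0 -> polyhedron (P `&` halfspace a
    b).
Proof.
move=> /polyhedron_hpoly [m [a1 [b1 ->]]].
have -> : hpoly a1 b1 `&` halfspace a b =
    hpoly (row_mx a1 a) (fun i => if fintype.split i is inl j then b1 j else b).
  apply/seteqP; split=> [x [h1 h2] i|x h].
    rewrite mul_mx_row; case: (split_ordP i) => j ->.
      by rewrite row_mxEl; exact: h1.
    by rewrite row_mxEr ord1; exact: h2.
  split=> [i|].
    have := h (lshift 1 i); rewrite mul_mx_row row_mxEl.
    case: splitP => j /= ij; first by rewrite (ord_inj ij).
    by have := ltn_ord i; rewrite ij ltnNge leq_addr.
  have := h (rshift m 0); rewrite mul_mx_row row_mxEr.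
  by case: splitP => // j /= E; have := ltn_ord j; rewrite -E addn0 ltnn.
exact: hpoly_polyhedron.
Qed.

Lemma face_polyhedron n (P F : set 'rV[R]_n) :
  polyhedron P -> face P F -> F !=set0 -> polyhedron F.
Proof.
move=> pP [a [b [Pab FE]]] F0.
have FE' : F = (P `&` halfspace a b) `&` halfspace (- a) (- b).
  rewrite FE; apply/seteqP; split=> x;
    rewrite /halfspace /= mulmxN [X in X <= - b]mxE.
    by move=> [Px e]; rewrite e !lexx.
  by move=> [[Px e1]]; rewrite lerN2 => e2; split=> //; apply/eqP;
    rewrite eq_le e1.
have [x Fx] := F0.
rewrite FE'; apply: polyhedron_cap; last by rewrite -FE'.
apply: polyhedron_cap => //; exists x.
by move: Fx; rewrite FE' => -[].
Qed.

Lemma face_sub n (P F : set 'rV[R]_n) : face P F -> F `<=` P.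
Proof. by move=> [a [b [_ ->]]] x []. Qed.

(** Induction on the number of constraints. If constraint [i] has no witness, it follows from the
    others: a point that violates only this constraint, divided by its value there, would be a
    witness. *)
Lemma irredundant_ex r k (c : 'M[R]_(r, k)) : exists k' (c' : 'M[R]_(r, k')),
  irredundant c' /\ hpoly c' (fun=> 1) = hpoly c (fun=> 1).
Proof.
elim: k c => [|k IH] c; first by exists 0, c; split=> // -[].
have [c_irr|] := EM (irredundant c); first by exists k.+1, c.
move=> /existsNP [i ci].
have cE (u : 'rV_r) j : (u *m col' i c) 0 j = (u *m c) 0 (lift i j).
  by rewrite !mxE; apply: eq_bigr => p _; rewrite mxE.
suff <- : hpoly (col' i c) (fun=> 1) = hpoly c (fun=> 1) by exact: IH.
apply/seteqP; split=> u Qu j; last by rewrite cE.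
have Qi q : q != i -> (u *m c) 0 q <= 1.
  by rewrite eq_sym => /unlift_some [p -> _]; rewrite -cE.
have [->|/Qi //] := eqVneq j i.
have [//|gt1] := lerP ((u *m c) 0 i) 1; case: ci.
have s0 : 0 < ((u *m c) 0 i)^-1 by rewrite invr_gt0 (lt_trans ltr01).
exists (((u *m c) 0 i)^-1 *: u) => [|q qi]; rewrite -scalemxAl mxE.
  by rewrite mulVf // gt_eqF // (lt_trans ltr01).
apply: le_lt_trans (_ : ((u *m c) 0 i)^-1 < 1).
  by rewrite ger_pMr // Qi.
by rewrite invf_lt1 // (lt_trans ltr01).
Qed.

(** A point [x0] with the fewest active constraints is in the relative interior. The constraints
    active there are implicit equations, whose common kernel gives [V]; the others have positive
    slack at [x0], and dividing by it turns every right-hand side into 1. *)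
Lemma presents_ex n (P : set 'rV[R]_n) : polyhedron P -> P !=set0 ->
  exists r k (c : 'M[R]_(r, k)) x0 (V : 'M[R]_(r, n)), presents c x0 V P.
Proof.
move=> /polyhedron_hpoly [m [a [b ->]]] P0.
have [//|//||x0 Px0 x0min] := @hpoly_min _ _ _ a b (hpoly a b).
  move=> x y Px Py i; rewrite -scalemxAl mulmxDl.
  by have := Px i; have := Py i; rewrite !mxE; lra.
pose I0 := active a b x0.
pose V := row_base (kermx (a *m coordproj I0)).
have VP (v : 'rV_n) : (v <= V)%MS <-> forall i, i \in I0 -> (v *m a) 0 i = 0.
  rewrite /V eq_row_base -mulmx_coordproj_eq0 -mulmxA.
  by split=> [/sub_kermxP|h //]; last exact/sub_kermxP.
(* Implicit equations become zero columns, that is the constraint [0 <= 1], which [irredundant_ex]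
   then removes. *)
pose c : 'M[R]_(_, m) := \matrix_(p, i)
  if i \in I0 then 0 else (V *m a) p i / (b i - (x0 *m a) 0 i).
have s_gt0 i : i \notin I0 -> 0 < b i - (x0 *m a) 0 i.
  by rewrite inE subr_gt0 lt_neqAle => ->; exact: Px0.
have cE u i : (u *m c) 0 i =
    if i \in I0 then 0 else (u *m V *m a) 0 i / (b i - (x0 *m a) 0 i).
  rewrite [LHS]mxE; case: ifPn => iI.
    by rewrite big1 // => p _; rewrite mxE iI mulr0.
  rewrite -mulmxA [X in X / _]mxE mulr_suml; apply: eq_bigr => p _.
  by rewrite [X in _ * X = _]mxE (negbTE iI) mulrA.
have [k [c' [irr cc']]] := irredundant_ex c.
exists (\rank (kermx (a *m coordproj I0))), k, c', x0, V.
split=> //; first exact: row_base_free.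
rewrite /cell cc'; apply/seteqP; split=> [x Px|_ [u [Qu _] <-] i].
  have /submxP [u uE] : (x - x0 <= V)%MS.
    apply/VP => i iI; move: (fintype.subsetP (x0min _ Px) _ iI) (iI).
    by rewrite !inE mulmxBl => /eqP e1 /eqP e2;
      rewrite mxE [X in _ + X]mxE e1 e2 subrr.
  exists u; last by rewrite /param -uE addrC subrK.
  split=> [i|]; last exact: finset.sub0set.
  rewrite cE; case: ifPn => [_|iI]; first exact: ler01.
  rewrite ler_pdivrMr ?s_gt0 // mul1r -uE mulmxBl mxE [X in _ + X]mxE.
  by rewrite lerB //; exact: Px.
rewrite /param mulmxDl mxE.
have := Qu i; rewrite cE; case: ifPn => [iI _|iI].
  by have /VP -> := submxMl u V; rewrite // addr0; exact: Px0.
by rewrite ler_pdivrMr ?s_gt0 // mul1r lerBrDl.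
Qed.

End PresentationExistence.

(** * Faces of simple polyhedra *)

Section SimpleLattice.
Variables (R : realFieldType) (n : nat).
Implicit Types (P F G : set 'rV[R]_n) (I J : set (set 'rV[R]_n)).

(** Intersecting with [P] makes the empty family yield [P] instead of the whole space. *)
Definition facet_cap P I : set 'rV[R]_n := P `&` \bigcap_(F in I) F.

Lemma dual_complex_sub P I J :
  dual_complex P I -> J `<=` I -> dual_complex P J.
Proof.
move=> [If [x [Px Ix]]] JI; split; first by move=> F /JI /If.
by exists x; split=> // F /JI; exact: Ix.
Qed.

Lemma dual_complex0 P : P !=set0 -> dual_complex P set0.
Proof. by move=> [x Px]; split=> [? []|]; exists x; split=> [|? []]. Qed.

Lemma facet_dual P F : facet P F -> dual_complex P [set F].
Proof.
move=> fF; split; first by move=> _ ->.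
have [/face_sub FP [x Fx] _] := fF.
by exists x; split=> [|_ ->] //; exact: FP.
Qed.

Lemma vertices_dual P : vertices (dual_complex P) = facet P.
Proof.
apply/seteqP; split=> F; last exact: facet_dual.
by move=> [+ _]; apply.
Qed.

(** Each simplex of the dual complex is the full set of facets through some point: from a common
    point of its facets, [active_shrink] moves off all the other facets. *)
Lemma dual_complex_cell r k (c : 'M[R]_(r, k)) x0 (V : 'M[R]_(r, n)) P I :
  presents c x0 V P -> simple_polyhedron P -> dual_complex P I ->
  exists u, [/\ hpoly c (fun=> 1) u,
    crank c (active c (fun=> 1) u) = #|active c (fun=> 1) u|,
    I = (fun i => cell c x0 V [set i]%SET) @` [set i | i \in active c (fun=> 1)
      u]
    & facet_cap P I = cell c x0 V (active c (fun=> 1) u)].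
Proof.
move=> presP [_ /(simple_crank presP) indep] [If [x [/(presentsE presP) [u Qu
  xE] Ix]]].
pose A := [set i | `[< I (cell c x0 V [set i]%SET) >]]%SET.
have IA : I = (fun i => cell c x0 V [set i]%SET) @` [set i | i \in A].
  apply/seteqP; split=> [F IF|_ [i + <-]];
    last by rewrite /mkset inE => /asboolP.
  have /(facet_cell presP) [i Fi] := If _ IF.
  by exists i => //=; rewrite inE -Fi; apply/asboolP.
have Au : A \subset active c (fun=> 1) u.
  apply/fintype.subsetP => i; rewrite inE => /asboolP /Ix.
  by rewrite xE (cell_param presP) finset.sub1set => -[].
have [v Qv vA] := active_shrink (indep u Qu) Qu Au.
exists v; split=> //; first exact: indep.
  by rewrite vA.
by rewrite vA IA /facet_cap (cell_bigcap presP).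
Qed.

Section Simple.
Variable P : set 'rV[R]_n.
Hypothesis simpleP : simple_polyhedron P.

Lemma dual_complex_presents I : dual_complex P I ->
  exists r k (c : 'M[R]_(r, k)) x0 (V : 'M[R]_(r, n)), presents c x0 V P.
Proof.
move=> [_ [x [Px _]]]; apply: presents_ex; last by exists x.
by case: simpleP.
Qed.

Lemma facet_cap_face I : dual_complex P I -> face P (facet_cap P I).
Proof.
move=> DI; have [r [k [c [x0 [V presP]]]]] := dual_complex_presents DI.
have [u [Qu _ _ ->]] := dual_complex_cell presP simpleP DI.
exact: cell_face.
Qed.

Lemma facet_cap_neq0 I : dual_complex P I -> facet_cap P I !=set0.
Proof. by case. Qed.

Lemma facet_cap_sub I J : dual_complex P I -> dual_complex P J ->
  facet_cap P I `<=` facet_cap P J <-> J `<=` I.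
Proof.
move=> DI DJ; split=> [IJ|JI x [Px Ix]]; last first.
  by split=> // F /JI; exact: Ix.
have [r [k [c [x0 [V presP]]]]] := dual_complex_presents DI.
have [u [Qu _ EI EI']] := dual_complex_cell presP simpleP DI.
have [v [Qv _ EJ EJ']] := dual_complex_cell presP simpleP DJ.
move: IJ; rewrite EI' EJ' (cell_sub presP) // => vu.
by rewrite EI EJ => _ [i /= iv <-]; exists i => //=;
  exact: (fintype.subsetP vu).
Qed.

Lemma facet_cap_inj I J : dual_complex P I -> dual_complex P J ->
  facet_cap P I = facet_cap P J -> I = J.
Proof.
move=> DI DJ IJ; apply/seteqP; split.
  by apply/(facet_cap_sub DJ DI); rewrite IJ.
by apply/(facet_cap_sub DI DJ); rewrite IJ.
Qed.

Lemma face_facet_cap F : face P F -> F !=set0 ->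
  exists2 I, dual_complex P I & F = facet_cap P I.
Proof.
move=> fF F0; have [x Fx] := F0.
have [|r [k [c [x0 [V presP]]]]] := @dual_complex_presents set0.
  by apply: dual_complex0; exists x; exact: face_sub Fx.
have [u Qu FE] := face_cell presP fF F0.
exists ((fun i => cell c x0 V [set i]%SET) @` [set i | i \in active c (fun=> 1)
  u]).
  split; first by move=> _ [i _ <-]; apply/(facet_cell presP); exists i.
  by rewrite (cell_bigcap presP) -FE.
by rewrite FE /facet_cap (cell_bigcap presP).
Qed.

Lemma affdim_facet_cap I : dual_complex P I ->
  exists2 k, I #= `I_k & affdim P = affdim (facet_cap P I) + k%:Z.
Proof.
move=> DI; have [r [k [c [x0 [V presP]]]]] := dual_complex_presents DI.
have [u [Qu rk EI EI']] := dual_complex_cell presP simpleP DI.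
exists #|active c (fun=> 1) u|; first by rewrite EI;
  exact: card_image_set (cell1_inj presP).
by rewrite (affdim_presented presP) EI' -(affdim_cell presP Qu) rk.
Qed.

End Simple.

(** Nonempty faces of [P] are cells, nonempty faces of cells are cells, and cells are faces of
    [P]. *)
Lemma face_trans P F E :
  polyhedron P -> face P F -> face F E -> E !=set0 -> face P E.
Proof.
move=> pP fF fE [x Ex]; have Fx := face_sub fE Ex; have Px := face_sub fF Fx.
have [|r [k [c [x0 [V presP]]]]] := presents_ex pP; first by exists x.
have [|u Qu FE] := face_cell presP fF; first by exists x.
rewrite FE in fE; have [|v Qv ->] := face_of_cell presP fE; first by exists x.
exact: cell_face.
Qed.

Lemma face_restrict P F E : face P E -> F `<=` P -> E `<=` F -> face F E.
Proof.
move=> [a [b [Pab EE]]] FP EF; exists a, b; split.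
  by move=> x /FP /Pab.
apply/seteqP; split=> [x Ex|x [Fx xb]]; last by rewrite EE; split=> //;
  exact: FP.
by split; [exact: EF|move: Ex; rewrite EE => -[]].
Qed.

End SimpleLattice.

(** * Links and isomorphisms of complexes *)

Lemma card_setD_II (T : choiceType) (I J : set T) (k l : nat) :
  I `<=` J -> I #= `I_k -> J #= `I_l -> (k <= l)%N /\ J `\` I #= `I_(l - k)%N.
Proof.
move=> IJ Ik Jl.
have fI : finite_set I by apply/finite_setP; exists k.
have fJ : finite_set J by apply/finite_setP; exists l.
have sIJ : (fset_set I `<=` fset_set J)%fset by rewrite -fset_set_sub.
split.
  by rewrite -(card_fset_set Ik) -(card_fset_set Jl) fsubset_leq_card.
have fD : finite_set (J `\` I) by exact: finite_setD.
rewrite -[J `\` I]fset_setK //; apply/card_eq_fsetP.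
by rewrite fset_setD // cardfsDS // (card_fset_set Ik) (card_fset_set Jl).
Qed.

Lemma card_eq1_set1 (T : choiceType) (I : set T) :
  I #= `I_1 -> exists x, I = [set x].
Proof.
move=> I1; have fI : finite_set I by apply/finite_setP; exists 1%N.
have /eqP/cardfs1P [x xE] := card_fset_set I1.
by exists x; rewrite -[I]fset_setK // xE set_fset1.
Qed.

Section ComplexIsomorphisms.
Variables V W X : Type.

Definition link (D : set (set V)) (I : set V) : set (set V) :=
  [set J | J `&` I = set0 /\ D (J `|` I)].

Definition complex_join (D : set (set V)) (E : set (set W)) : set (set (V + W))
  :=
  [set J | D [set v | J (inl v)] /\ E [set w | J (inr w)]].

Lemma complex_iso_trans (D : set (set V)) (E : set (set W)) (F : set (set X)) :
  complex_iso D E -> complex_iso E F -> complex_iso D F.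
Proof.
move=> [f [fbij fE]] [g [gbij gE]]; exists (g \o f); split.
  exact: set_bij_comp gbij.
move=> I ID; rewrite fE // -image_comp gE // => _ [v /ID Dv <-].
exact: set_bij_homo fbij _ Dv.
Qed.

Lemma set_bij_inverse (v0 : V) (A : set V) (B : set W) (f : V -> W) :
  set_bij A B f -> exists g : W -> V,
    [/\ set_bij B A g, {in A, cancel f g} & {in B, cancel g f}].
Proof.
move=> [fun_f inj_f surj_f].
(* Complex isomorphisms are total functions, so [v0] serves as the value of the inverse outside
   [B]. *)
have /choice [g gP] (w : W) : exists v, B w -> A v /\ f v = w.
  by have [/surj_f [v Av fv]|nB] := EM (B w); [exists v | exists v0].
have gf : {in A, cancel f g}.
  move=> v /[!inE] Av; have [Ag fg] := gP _ (fun_f _ Av).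
  by apply: inj_f; rewrite ?inE.
exists g; split=> //; last by move=> w /[!inE] /gP [].
split=> [w /gP [] //|w w'|v Av].
  by rewrite !inE => /gP [_ e] /gP [_ e'] ww; rewrite -e -e' ww.
by exists (f v); [exact: fun_f|apply: gf; rewrite inE].
Qed.

Lemma complex_iso_sym (v0 : V) (D : set (set V)) (E : set (set W)) :
  complex_iso D E -> complex_iso E D.
Proof.
move=> [f [fbij fE]]; have [g [gbij fK gK]] := set_bij_inverse v0 fbij.
exists g; split=> // J JE; rewrite fE; last first.
  by move=> _ [w /JE Ew <-]; exact: set_bij_homo gbij _ Ew.
rewrite image_comp; suff -> : (f \o g) @` J = J by [].
rewrite -[RHS]image_id; apply: eq_imagel => w Jw /=.
by rewrite gK // inE; exact: JE.
Qed.
End ComplexIsomorphisms.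

(** * Faces of a simple polyhedron and links in its dual complex *)

Section FaceLink.
Variables (R : realFieldType) (n : nat) (P : set 'rV[R]_n).
Variable I : set (set 'rV[R]_n).
Hypotheses (simpleP : simple_polyhedron P) (DI : dual_complex P I).

Local Notation F := (facet_cap P I).
Local Notation D := (dual_complex P).

Lemma affdim_facet_cap_sub J : D J -> I `<=` J ->
  exists2 k, J `\` I #= `I_k & affdim F = affdim (facet_cap P J) + k%:Z.
Proof.
move=> DJ IJ.
have [k Ik dI] := affdim_facet_cap simpleP DI.
have [l Jl dJ] := affdim_facet_cap simpleP DJ.
have [kl JIl] := card_setD_II IJ Ik Jl; exists (l - k)%N => //.
by apply: (addIr k%:Z); rewrite -dI dJ -[RHS]addrA -PoszD subnK.
Qed.

Lemma face_of_facet_cap E : face F E -> E !=set0 ->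
  exists J, [/\ D J, I `<=` J & E = facet_cap P J].
Proof.
move=> fE E0; have [J DJ EJ] : exists2 J, D J & E = facet_cap P J.
  apply: (face_facet_cap simpleP) => //; apply: face_trans fE E0.
    by case: simpleP.
  exact: facet_cap_face.
exists J; split=> //; apply/(facet_cap_sub simpleP DJ DI).
by rewrite -EJ; exact: face_sub.
Qed.

Lemma facet_cap_face_of J : D J -> I `<=` J -> face F (facet_cap P J).
Proof.
move=> DJ IJ; apply: face_restrict (facet_cap_face simpleP DJ) _ _.
  by move=> x [].
exact/(facet_cap_sub simpleP DJ DI).
Qed.

(** A nonempty face of [F] comes from a simplex [J] containing [I], with codimension in [F] equal to
    the size of [J] minus [I]; for a facet this difference is one element. *)
Lemma facet_facet_cap E : facet F E <->
  exists s, [/\ ~ I s, D (I `|` [set s]) & E = facet_cap P (I `|` [set s])].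
Proof.
split=> [[fE E0 dE]|[s [Is DIs ->]]].
  have [J [DJ IJ EJ]] := face_of_facet_cap fE E0.
  have [k JIk dF] := affdim_facet_cap_sub DJ IJ.
  have k1 : k = 1%N.
    by move: dF; rewrite dE EJ => /addrI [].
  rewrite k1 in JIk; have [s JIs] := card_eq1_set1 JIk.
  have EIs : J = I `|` [set s] by rewrite -JIs setDUK.
  have [_ Is] : (J `\` I) s by rewrite JIs.
  by exists s; rewrite -EIs.
have IIs : I `<=` I `|` [set s] by exact: subsetUl.
split; first exact: facet_cap_face_of.
  exact: facet_cap_neq0.
have [k JIk ->] := affdim_facet_cap_sub DIs IIs.
suff <- : 1%N = k by [].
apply/card_eq_II; apply: card_eq_trans JIk.
rewrite (_ : _ `\` _ = [set s]); last first.
  by apply/seteqP; split=> [x [[|-> //]]|_ ->]; [move=> ? []|split; [right|]].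
by rewrite card_eq_sym; exact: card_set1.
Qed.

Lemma facet_cap_set1_sub J s : D J -> I `<=` J -> D (I `|` [set s]) -> ~ I s ->
  facet_cap P J `<=` facet_cap P (I `|` [set s]) <-> J s.
Proof.
move=> DJ IJ DIs Is; rewrite (facet_cap_sub simpleP DJ DIs); split.
  by move=> h; apply: h; right.
by move=> Js x [/IJ //|->].
Qed.

Lemma facet_cap_set1_inj s t : D (I `|` [set s]) -> D (I `|` [set t]) -> ~ I s
  ->
  facet_cap P (I `|` [set s]) = facet_cap P (I `|` [set t]) -> s = t.
Proof.
move=> Ds Dt Is /(facet_cap_inj simpleP Ds Dt) st.
by have : (I `|` [set t]) s; [rewrite -st; right | case].
Qed.

(** The facets of [F] through the face of a simplex [J] correspond to the elements of [J] outside
    [I], whose number is the codimension in [F]. *)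
Lemma simple_facet_cap : simple_polyhedron F.
Proof.
split.
  apply: face_polyhedron (facet_cap_face simpleP DI) (facet_cap_neq0 DI).
  by case: simpleP.
move=> E k fE E0 dE; have [J [DJ IJ EJ]] := face_of_facet_cap fE E0.
have [l JIl dF] := affdim_facet_cap_sub DJ IJ.
have lk : l = k by move: dF; rewrite dE EJ => /addrI [].
have Dset1 s : J s -> D (I `|` [set s]).
  by move=> Js; apply: dual_complex_sub DJ _ => x [/IJ //|->].
have -> : [set G | facet F G /\ E `<=` G] =
    (fun s => facet_cap P (I `|` [set s])) @` (J `\` I).
  apply/seteqP; split=> [G [/facet_facet_cap [s [Is DIs ->]]]|_ [s [Js Is] <-]].
    by rewrite EJ facet_cap_set1_sub // => Js; exists s.
  split; first by apply/facet_facet_cap; exists s; split=> //; exact: Dset1.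
  by rewrite EJ facet_cap_set1_sub //; exact: Dset1.
rewrite -lk; apply: card_eq_trans JIl; apply: inj_card_eq => s t.
move=> /[!inE] -[Js Is] [Jt It]; apply: facet_cap_set1_inj => //; exact: Dset1.
Qed.

Lemma vertices_link s : vertices (link D I) s <-> ~ I s /\ D (I `|` [set s]).
Proof.
rewrite /vertices /link /=; rewrite [I `|` _]setUC.
split=> -[h Ds]; split=> //.
  by move=> Is; have : ([set s] `&` I) s by []; rewrite h.
by apply/seteqP; split=> x // [-> /h].
Qed.

(** A vertex [s] of the link goes to the facet of [F] cut out by [s]. A family of these facets has a
    common point exactly when the facets of [P] in [J] and [I] together do. *)
Lemma link_facet_cap : complex_iso (link D I) (dual_complex F).
Proof.
exists (fun s => facet_cap P (I `|` [set s])); rewrite vertices_dual; split.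
  split=> [s /vertices_link [Is Ds]|s t|E].
  - by apply/facet_facet_cap; exists s.
  - move=> /[!inE] /vertices_link [Is Ds] /vertices_link [It Dt].
    exact: facet_cap_set1_inj.
  - move=> /facet_facet_cap [s [Is Ds ->]]; exists s => //.
    exact/vertices_link.
move=> J Jv; split=> [[JI [JIf [x [Px JIx]]]]|[_ [x [[Px Ix] Jx]]]].
  split=> [_ [s Js <-]|].
    have [Is Ds] := (vertices_link s).1 (Jv s Js).
    by apply/facet_facet_cap; exists s.
  exists x; split; first by split=> // G IG; apply: JIx; right.
  by move=> _ [s Js <-]; split=> // G [IG|->]; apply: JIx; [right|left].
split.
  apply/seteqP; split=> s // [/Jv /vertices_link [Is _]].
  by move=> /Is.
split.
  move=> s [/Jv /vertices_link [_ [+ _]]|Is]; last by case: DI => + _; apply.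
  by apply; right.
exists x; split=> // s [Js|/Ix //].
have [_] : facet_cap P (I `|` [set s]) x by apply: Jx; exists s.
by apply; right.
Qed.

End FaceLink.

(** * Dividing out the lineality space *)

Section PointedModel.
Variable R : realFieldType.

(** Minimum ratio test: among the constraints that increase along [v], the one with the least ratio
    of slack to speed is hit first. *)
Lemma hpoly_exit n m (a : 'M[R]_(n, m)) b (u v : 'rV[R]_n) i0 :
  hpoly a b u -> 0 < (v *m a) 0 i0 ->
  exists t i, [/\ hpoly a b (u + t *: v), 0 < (v *m a) 0 i
    & i \in active a b (u + t *: v)].
Proof.
move=> Pu v0.
pose f i := (b i - (u *m a) 0 i) / (v *m a) 0 i.
pose i := [arg min_(i < i0 | 0 < (v *m a) 0 i) f i]%O.
have [vi fi] : 0 < (v *m a) 0 i /\ forall j, 0 < (v *m a) 0 j -> f i <= f j.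
  by rewrite /i; case: arg_minP.
have E j : ((u + f i *: v) *m a) 0 j = (u *m a) 0 j + f i * (v *m a) 0 j.
  by rewrite mulmxDl -scalemxAl mxE [X in _ + X]mxE.
exists (f i), i; split=> // [j|]; last first.
  by rewrite inE E divfK; [rewrite addrC subrK|rewrite gt_eqF].
rewrite E -lerBrDl; have [vj|vj] := ltP 0 ((v *m a) 0 j).
  by rewrite -ler_pdivlMr //; exact: fi.
apply: le_trans (_ : 0 <= _); last by rewrite subr_ge0; exact: Pu.
apply: mulr_ge0_le0 => //; apply: divr_ge0; last exact: ltW.
by rewrite subr_ge0; exact: Pu.
Qed.

(** The two matrices have the same left kernel. If a direction is killed by the active columns but
    not by all columns, it or its opposite increases some constraint; following it until a
    constraint is hit enlarges the active set, against maximality. *)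
Lemma hpoly_maximal_rank r k (c : 'M[R]_(r, k)) u :
  hpoly c (fun=> 1) u ->
  (forall u', hpoly c (fun=> 1) u' ->
     active c (fun=> 1) u \subset active c (fun=> 1) u' ->
     active c (fun=> 1) u' \subset active c (fun=> 1) u) ->
  crank c (active c (fun=> 1) u) = \rank c.
Proof.
set A := active c (fun=> 1) u => Qu umax.
suff ker_sub : (kermx (c *m coordproj A) <= kermx c)%MS.
  apply/eqP; rewrite eqn_leq /crank mxrankM_maxl /=.
  have := mxrankS ker_sub; rewrite !mxrank_ker leq_sub2lE //;
    exact: rank_leq_row.
have no_exit (v : 'rV_r) i0 : (forall i, i \in A -> (v *m c) 0 i = 0) ->
    ~ 0 < (v *m c) 0 i0.
  move=> vA vi0; have [t [i [Qt vi it]]] := hpoly_exit Qu vi0.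
  have Aact : A \subset active c (fun=> 1) (u + t *: v).
    apply/fintype.subsetP => j jA; move: (jA); rewrite !inE mulmxDl -scalemxAl.
    by rewrite [X in _ -> X == _]mxE [X in _ -> _ + X == _]mxE vA // mulr0
      addr0.
  have /vA e := fintype.subsetP (umax _ Qt Aact) _ it.
  by rewrite e ltxx in vi.
apply/row_subP => j; apply/sub_kermxP.
have /sub_kermxP := row_sub j (kermx (c *m coordproj A)).
set v := row j _; rewrite mulmxA => /mulmx_coordproj_eq0 vA.
apply/rowP => i; rewrite [RHS]mxE; apply/eqP; rewrite eq_le; apply/andP; split.
  by rewrite leNgt; apply/negP; exact: no_exit.
rewrite -oppr_le0 leNgt; apply/negP.
suff -> : - (v *m c) 0 i = (- v *m c) 0 i.
  by apply: no_exit => q qA; rewrite mulNmx mxE vA // oppr0.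
by rewrite mulNmx [RHS]mxE.
Qed.

Lemma dual_complex_cells r k n (c : 'M[R]_(r, k)) x0 (V : 'M[R]_(r, n)) P
    (A : {set 'I_k}) :
  presents c x0 V P ->
  dual_complex P ((fun i => cell c x0 V [set i]%SET) @` [set i | i \in A]) <->
  exists2 u, hpoly c (fun=> 1) u & A \subset active c (fun=> 1) u.
Proof.
move=> presP; rewrite /dual_complex /mkset (cell_bigcap presP).
split=> [[_ [_ [u [Qu Au] _]]]|[u Qu Au]]; first by exists u.
split; first by move=> _ [i _ <-]; apply/(facet_cell presP); exists i.
by exists (param x0 V u); apply/(cell_param presP).
Qed.

(** The dual complex only depends on which sets of constraints can be active together, so matching
    constraints by index is an isomorphism. *)
Lemma presented_iso r r' k n n' (c : 'M[R]_(r, k)) (c' : 'M[R]_(r', k)) x0 x0'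
    (V : 'M[R]_(r, n)) (V' : 'M[R]_(r', n')) P P' :
  presents c x0 V P -> presents c' x0' V' P' ->
  (forall A : {set 'I_k},
    (exists2 u, hpoly c (fun=> 1) u & A \subset active c (fun=> 1) u) <->
    (exists2 u, hpoly c' (fun=> 1) u & A \subset active c' (fun=> 1) u)) ->
  complex_iso (dual_complex P) (dual_complex P').
Proof.
move=> presP presP' cc'.
pose g i := cell c x0 V [set i]%SET; pose g' i := cell c' x0' V' [set i]%SET.
have /choice [f fP] G : exists G', forall i, G = g i -> G' = g' i.
  have [[i ->]|nG] := EM (exists i, G = g i).
    by exists (g' i) => j /(cell1_inj presP) ->.
  by exists set0 => i Gi; case: nG; exists i.
exists f; rewrite !vertices_dual; split.
  split=> [G /(facet_cell presP) [i /fP ->]|G H|H /(facet_cell presP') [i ->]].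
  - by apply/(facet_cell presP'); exists i.
  - move=> /[!inE] /(facet_cell presP) [i Gi] /(facet_cell presP) [j Hj].
    by rewrite (fP _ _ Gi) (fP _ _ Hj) Gi Hj => /(cell1_inj presP') ->.
  - by exists (g i); [apply/(facet_cell presP); exists i|exact: fP].
move=> I If; pose A := [set i | `[< I (g i) >]]%SET.
have IA : I = g @` [set i | i \in A].
  apply/seteqP; split=> [G IG|_ [i + <-]];
    last by rewrite /mkset inE => /asboolP.
  have /(facet_cell presP) [i Gi] := If _ IG.
  by exists i => //=; rewrite inE /g -Gi; apply/asboolP.
have fIA : f @` I = g' @` [set i | i \in A].
  rewrite IA image_comp; apply: eq_imagel => i _ /=; exact: fP.
by rewrite fIA IA (dual_complex_cells _ presP) (dual_complex_cells _ presP').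
Qed.

Lemma presents_hpoly r k (c : 'M[R]_(r, k)) :
  irredundant c -> presents c 0 1%:M (hpoly c (fun=> 1)).
Proof.
move=> irr; split=> //; first by rewrite row_free_unit unitmx1.
apply/seteqP; split=> [u Qu|_ [u [Qu _] <-]];
  last by rewrite /param add0r mulmx1.
by exists u; [split=> //; exact: finset.sub0set|rewrite /param add0r mulmx1].
Qed.

(** Dividing out the lineality space makes the polyhedron pointed, so that its
    dimension is read off any maximal simplex of its dual complex. *)
Lemma pointed_model n (P : set 'rV[R]_n) :
  simple_polyhedron P -> P !=set0 ->
  exists r (P' : set 'rV[R]_r), [/\ simple_polyhedron P',
    complex_iso (dual_complex P) (dual_complex P')
    & forall N, dual_complex P N ->
        (forall N', dual_complex P N' -> N `<=` N' -> N' `<=` N) ->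
        exists2 k, N #= `I_k & affdim P' = k%:Z].
Proof.
move=> simpleP P0; have [polyP /[dup] sP] := simpleP.
have [r [k [c [x0 [V presP]]]]] := presents_ex polyP P0.
move=> /(simple_crank presP) indep.
(* In this full-rank factorization of [c], the map [u] to [u *m e] is the quotient by the left
   kernel of [c], the lineality space; [c'] describes the image. *)
pose e := col_base c; pose c' := row_base c.
have ec : e *m c' = c by exact: mulmx_base.
have QE u : hpoly c' (fun=> 1) (u *m e) <-> hpoly c (fun=> 1) u.
  by rewrite /hpoly /mkset -mulmxA ec.
have actE u : active c' (fun=> 1) (u *m e) = active c (fun=> 1) u.
  by rewrite /active -mulmxA ec.
have e_surj (u' : 'rV_(\rank c)) : exists u, u' = u *m e.
  by exists (u' *m pinvmx e); rewrite -mulmxA mulVpmx ?mulmx1 ?col_base_full.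
pose P' := hpoly c' (fun=> 1).
have presP' : presents c' 0 1%:M P'.
  have [_ irr _] := presP; apply: presents_hpoly => i; have [w wi wj] := irr i.
  by exists (w *m e) => [|j]; rewrite -mulmxA ec //; exact: wj.
exists (\rank c), P'; split.
- split; first by apply: hpoly_polyhedron; exists 0; exact: Q0.
  apply/(simple_crank presP') => u'; have [u ->] := e_surj u'.
  move=> /QE Qu; rewrite actE; apply/eqP; rewrite eqn_leq; apply/andP; split.
    by apply: leq_trans (rank_coordproj R _); exact: mxrankM_maxr.
  rewrite -indep //; move: (active _ _ _) => A.
  by rewrite /crank -[X in (\rank (X *m _) <= _)%N]ec -mulmxA mxrankM_maxr.
- apply: presented_iso presP presP' _ => A; split=> [[u Qu Au]|[u' + +]].
    by exists (u *m e); [exact/QE|rewrite actE].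
  have [u ->] := e_surj u'; rewrite actE => /QE Qu Au.
  by exists u.
- move=> N DN Nmax; have [u [Qu rk NE _]] := dual_complex_cell presP simpleP DN.
  exists #|active c (fun=> 1) u|.
    by rewrite {1}NE; exact: card_image_set (cell1_inj presP).
  rewrite (affdim_presented presP') -rk hpoly_maximal_rank // => u' Qu' uu'.
  apply/fintype.subsetP => i iu'.
  have : N (cell c x0 V [set i]%SET).
    apply: (Nmax ((fun i => cell c x0 V [set i]%SET) @`
      [set i | i \in active c (fun=> 1) u'])); last by exists i.
      by apply/(dual_complex_cells _ presP); exists u'.
    by rewrite NE => _ [j ju <-]; exists j => //=; exact: (fintype.subsetP uu').
  by rewrite NE => -[j ju /(cell1_inj presP) <-].
Qed.

End PointedModel.

(** * Products and joins *)

Section Products.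
Variable R : realFieldType.

Lemma polyhedron_directed n (P : set 'rV[R]_n) : polyhedron P -> P !=set0 ->
  exists x p (W : 'M[R]_(p, n)), directed P x W.
Proof.
move=> pP P0; have [r [k [c [x0 [V presP]]]]] := presents_ex pP P0.
have dP := directed_cell presP (Q0 c).
have [_ _ PE] := presP.
by rewrite active0 -PE in dP; do 3 eexists; exact: dP.
Qed.

Lemma affdim_prod n1 n2 (P1 : set 'rV[R]_n1) (P2 : set 'rV[R]_n2) :
  polyhedron P1 -> P1 !=set0 -> polyhedron P2 -> P2 !=set0 ->
  affdim (polyhedron_prod P1 P2) = affdim P1 + affdim P2.
Proof.
move=> pP1 P10 pP2 P20.
have [x1 [p1 [W1 d1]]] := polyhedron_directed pP1 P10.
have [x2 [p2 [W2 d2]]] := polyhedron_directed pP2 P20.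
rewrite (affdim_directed d1) (affdim_directed d2).
by rewrite (affdim_directed (directed_prod d1 d2)) rank_diag_block_mx.
Qed.

Lemma affdim_ge0 n (P : set 'rV[R]_n) : polyhedron P -> P !=set0 ->
  exists k : nat, affdim P = k%:Z.
Proof.
move=> pP P0; have [x [p [W d]]] := polyhedron_directed pP P0.
by exists (\rank W); exact: affdim_directed d.
Qed.

Lemma affdim0_point n (P : set 'rV[R]_n) : polyhedron P -> P !=set0 ->
  affdim P = 0 -> is_point P.
Proof.
move=> pP P0; have [x [p [W d]]] := polyhedron_directed pP P0.
rewrite (affdim_directed d) => -[/eqP]; rewrite mxrank_eq0 => /eqP W0.
have [Px PW _] := d; exists x; apply/seteqP; split=> [y /PW|_ -> //].
by rewrite W0 => /submx0null /eqP; rewrite subr_eq0 => /eqP.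
Qed.

Lemma face_set0 n (P : set 'rV[R]_n) : face P set0.
Proof.
exists 0, 1; split=> [x _|]; first by rewrite /halfspace /= mulmx0 mxE ler01.
apply/seteqP; split=> // x [_ /=]; rewrite mulmx0 mxE => /eqP.
by rewrite eq_sym oner_eq0.
Qed.

Lemma mulmx_col_mx n1 n2 (z : 'rV[R]_(n1 + n2)) (a1 : 'cV[R]_n1) (a2 :
  'cV[R]_n2) :
  (z *m col_mx a1 a2) 0 0 = (lsubmx z *m a1) 0 0 + (rsubmx z *m a2) 0 0.
Proof. by rewrite -[z in LHS]hsubmxK mul_row_col mxE. Qed.

Lemma face_prod n1 n2 (P1 F1 : set 'rV[R]_n1) (P2 F2 : set 'rV[R]_n2) :
  face P1 F1 -> face P2 F2 ->
  face (polyhedron_prod P1 P2) (polyhedron_prod F1 F2).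
Proof.
move=> [a1 [b1 [Pab1 ->]]] [a2 [b2 [Pab2 ->]]].
exists (col_mx a1 a2), (b1 + b2); split.
  by move=> z [/Pab1 + /Pab2]; rewrite /halfspace /= mulmx_col_mx; exact: lerD.
apply/seteqP; split=> z; rewrite /polyhedron_prod /= mulmx_col_mx.
  by move=> [[P1z ->] [P2z ->]].
move=> [[P1z P2z] zb]; have := Pab1 _ P1z; have := Pab2 _ P2z.
by rewrite /halfspace /= => h1 h2; split; split=> //; lra.
Qed.

(** A linear form on the product is a sum of forms on the factors, so it is maximal at a point
    exactly when both parts are. The values at one point [z] of [F] give the two supporting
    hyperplanes. *)
Lemma prod_face n1 n2 (P1 : set 'rV[R]_n1) (P2 : set 'rV[R]_n2) F :
  face (polyhedron_prod P1 P2) F -> F !=set0 -> exists F1 F2,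
    [/\ face P1 F1, face P2 F2, F1 !=set0, F2 !=set0 & F = polyhedron_prod F1
      F2].
Proof.
move=> [a [b [Pab FE]]] [z Fz].
have [zP zb] : polyhedron_prod P1 P2 z /\ (z *m a) 0 0 = b by rewrite FE in Fz.
have [P1z P2z] := zP.
have aE (y : 'rV_(n1 + n2)) :
    (y *m a) 0 0 = (lsubmx y *m usubmx a) 0 0 + (rsubmx y *m dsubmx a) 0 0.
  by rewrite -mulmx_col_mx vsubmxK.
have le1 x : P1 x -> (x *m usubmx a) 0 0 <= (lsubmx z *m usubmx a) 0 0.
  move=> P1x; have /Pab : polyhedron_prod P1 P2 (row_mx x (rsubmx z)).
    by rewrite /polyhedron_prod /= row_mxKl row_mxKr.
  by rewrite /halfspace /= -zb !aE row_mxKl row_mxKr lerD2r.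
have le2 x : P2 x -> (x *m dsubmx a) 0 0 <= (rsubmx z *m dsubmx a) 0 0.
  move=> P2x; have /Pab : polyhedron_prod P1 P2 (row_mx (lsubmx z) x).
    by rewrite /polyhedron_prod /= row_mxKl row_mxKr.
  by rewrite /halfspace /= -zb !aE row_mxKl row_mxKr lerD2l.
exists (P1 `&` [set x | (x *m usubmx a) 0 0 = (lsubmx z *m usubmx a) 0 0]).
exists (P2 `&` [set x | (x *m dsubmx a) 0 0 = (rsubmx z *m dsubmx a) 0 0]).
split; first by do 2 eexists; split; [exact: le1|].
- by do 2 eexists; split; [exact: le2|].
- by exists (lsubmx z).
- by exists (rsubmx z).
rewrite FE; apply/seteqP; split=> y; rewrite /polyhedron_prod /= -zb !aE.
  move=> [[P1y P2y] yb]; have := le1 _ P1y; have := le2 _ P2y.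
  by move=> h1 h2; split; split=> //; lra.
by move=> [[P1y ->] [P2y ->]].
Qed.

Lemma prod_sub n1 n2 (A1 B1 : set 'rV[R]_n1) (A2 B2 : set 'rV[R]_n2) :
  A1 !=set0 -> A2 !=set0 ->
  polyhedron_prod A1 A2 `<=` polyhedron_prod B1 B2 <->
  A1 `<=` B1 /\ A2 `<=` B2.
Proof.
move=> [x1 A1x] [x2 A2x]; split=> [h|[h1 h2] z [/h1 + /h2] //].
split=> [y1 Ay1|y2 Ay2].
  have [] : polyhedron_prod B1 B2 (row_mx y1 x2).
    by apply: h; rewrite /polyhedron_prod /= row_mxKl row_mxKr.
  by rewrite row_mxKl.
have [] : polyhedron_prod B1 B2 (row_mx x1 y2).
  by apply: h; rewrite /polyhedron_prod /= row_mxKl row_mxKr.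
by rewrite row_mxKr.
Qed.

End Products.

(** * Full subcomplexes and maximal simplices *)

Section Restriction.

Definition restrict (V : Type) (D : set (set V)) (Y : set V) : set (set V) :=
  [set J | D J /\ J `<=` Y].

Definition maximal_simplex (V : Type) (D : set (set V)) (N : set V) : Prop :=
  D N /\ forall N', D N' -> N `<=` N' -> N' `<=` N.

Lemma vertices_restrict (V : Type) (D : set (set V)) (Y : set V) :
  Y `<=` vertices D -> vertices (restrict D Y) = Y.
Proof.
move=> YD; apply/seteqP; split=> v.
  by move=> [_]; apply.
by move=> Yv; split=> [|_ ->] //; exact: YD.
Qed.

Lemma maximal_simplex_iso (V W : Type) (D : set (set V)) (E : set (set W)) N :
  complex_iso D E -> (forall J, D J -> J `<=` vertices D) ->
  (forall J, E J -> J `<=` vertices E) ->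
  maximal_simplex D N -> exists2 N', maximal_simplex E N' & N' #= N.
Proof.
move=> [f [[fun_f inj_f surj_f] fE]] Dv Ev [DN Nmax]; exists (f @` N);
  last first.
  apply: inj_card_eq => v w /[!inE] Nv Nw; apply: inj_f; rewrite inE.
    exact: Dv Nv.
  exact: Dv Nw.
split; first by rewrite -fE //; exact: Dv.
move=> N' EN' NN'; pose J := [set v | vertices D v /\ N' (f v)].
have JE : f @` J = N'.
  apply/seteqP; split=> [_ [v [_ N'v] <-] //|w N'w].
  by have [v Dvv fv] := surj_f _ (Ev _ EN' _ N'w); exists v => //; split;
    rewrite ?fv.
have DJ : D J by rewrite fE ?JE // => v [].
rewrite -JE; apply: image_subset; apply: Nmax => // v Nv; split;
  first exact: Dv Nv.
by apply: NN'; exists v.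
Qed.
End Restriction.

(** * A polyhedron whose dual complex is a join *)

Section JoinDecomposition.
Variables (R : realFieldType) (n : nat) (G : set 'rV[R]_n).
Hypothesis simpleG : simple_polyhedron G.
Local Notation D := (dual_complex G).

(** A simplex whose face has the least dimension is maximal, because adding facets to a simplex
    strictly lowers that dimension. *)
Lemma maximal_simplex_restrict (Y : set (set 'rV[R]_n)) : G !=set0 ->
  exists N, maximal_simplex (restrict D Y) N.
Proof.
move=> G0.
have polyC N : D N -> exists k : nat, affdim (facet_cap G N) = k%:Z.
  move=> DN; apply: affdim_ge0; last exact: facet_cap_neq0.
  by case: (simple_facet_cap simpleG DN).
have D0 := dual_complex0 G0.
have ex : exists k, `[< exists2 N, restrict D Y N &
    affdim (facet_cap G N) = k%:Z >].
  have [k dk] := polyC _ D0.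
  by exists k; apply/asboolP; exists set0 => //; split=> // ? [].
case: (ex_minnP ex) => k /asboolP [N [DN NY] Nk] kmin; exists N; split=> //.
move=> N' [DN' N'Y] NN'.
have [l N'Nl dN] := affdim_facet_cap_sub simpleG DN DN' NN'.
have [k' dk'] := polyC _ DN'.
have /kmin : `[< exists2 N, restrict D Y N & affdim (facet_cap G N) = k'%:Z >].
  by apply/asboolP; exists N'.
move: dN; rewrite Nk dk' -PoszD => -[->] kl.
have l0 : l = 0%N by apply/eqP; rewrite -leqn0 -(leq_add2l k') addn0.
move: N'Nl; rewrite l0 II0 card_eq0 => /eqP.
by rewrite setD_eq0.
Qed.

Section Split.
Variables Y1 Y2 : set (set 'rV[R]_n).
Hypotheses (Y1G : Y1 `<=` facet G) (Y2G : Y2 `<=` facet G).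
Hypotheses (Y12_cover : facet G `<=` Y1 `|` Y2) (Y12_disj : Y1 `&` Y2 = set0).
Hypothesis joinG : forall J1 J2, restrict D Y1 J1 -> restrict D Y2 J2 -> D (J1
  `|` J2).

(** A vertex of [Y2] in the link of [N2] could be added to [N2], so maximality leaves only vertices
    of [Y1]; the join hypothesis gives the converse. *)
Lemma link_maximal_simplex N2 :
  maximal_simplex (restrict D Y2) N2 -> link D N2 = restrict D Y1.
Proof.
move=> [[DN2 N2Y] N2max]; apply/seteqP; split=> J.
  move=> [JN2 DJ]; split.
    by apply: dual_complex_sub DJ _; exact: subsetUl.
  move=> s Js; have /Y12_cover [//|Y2s] : facet G s by case: DJ => + _; apply;
    left.
  suff N2s : N2 s by have : (J `&` N2) s by []; rewrite JN2.
  apply: (N2max (N2 `|` [set s])); last by right.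
    split; last by move=> x [/N2Y|->].
    by apply: dual_complex_sub DJ _ => x [|->]; [right|left].
  exact: subsetUl.
move=> [DJ JY]; split; last exact: joinG.
apply/seteqP; split=> // s [/JY Y1s /N2Y Y2s].
by have : (Y1 `&` Y2) s by []; rewrite Y12_disj.
Qed.

End Split.

Section Join.
Variables Y1 Y2 : set (set 'rV[R]_n).
Hypotheses (Y1G : Y1 `<=` facet G) (Y2G : Y2 `<=` facet G).
Hypotheses (Y12_cover : facet G `<=` Y1 `|` Y2) (Y12_disj : Y1 `&` Y2 = set0).
Hypothesis joinG : forall J1 J2, restrict D Y1 J1 -> restrict D Y2 J2 -> D (J1
  `|` J2).

Section CombIso.
Variables (m1 m2 : nat) (K1 : set 'rV[R]_m1) (K2 : set 'rV[R]_m2).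
Hypotheses (simple1 : simple_polyhedron K1) (simple2 : simple_polyhedron K2).
Hypotheses (iso1 : complex_iso (restrict D Y1) (dual_complex K1)).
Hypotheses (iso2 : complex_iso (restrict D Y2) (dual_complex K2)).
Hypotheses (G0 : G !=set0) (K10 : K1 !=set0) (K20 : K2 !=set0).
Hypothesis dimG : affdim G = affdim K1 + affdim K2.

(** The face of a simplex [I] is sent to the product of the faces of [K1] and [K2] that correspond
    to the parts of [I] in [Y1] and [Y2]. Codimensions add, so [dimG] makes the dimensions agree. *)
Lemma comb_iso_join : comb_iso G (polyhedron_prod K1 K2).
Proof.
have [poly1 _] := simple1; have [poly2 _] := simple2.
have vY1 : vertices (restrict D Y1) = Y1.
  by apply: vertices_restrict; rewrite vertices_dual.
have vY2 : vertices (restrict D Y2) = Y2.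
  by apply: vertices_restrict; rewrite vertices_dual.
move: iso1 => [g1 []]; rewrite vY1 vertices_dual => -[fun1 inj1 surj1] g1E.
move: iso2 => [g2 []]; rewrite vY2 vertices_dual => -[fun2 inj2 surj2] g2E.
pose h1 I := g1 @` (I `&` Y1); pose h2 I := g2 @` (I `&` Y2).
have Dr1 I : D I -> restrict D Y1 (I `&` Y1).
  by move=> DI; split; [apply: dual_complex_sub DI _|]; move=> ? [].
have Dr2 I : D I -> restrict D Y2 (I `&` Y2).
  by move=> DI; split; [apply: dual_complex_sub DI _|]; move=> ? [].
have D1 I : D I -> dual_complex K1 (h1 I).
  by move=> /Dr1 rI; rewrite -g1E //; exact: subIsetr.
have D2 I : D I -> dual_complex K2 (h2 I).
  by move=> /Dr2 rI; rewrite -g2E //; exact: subIsetr.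
pose p I := polyhedron_prod (facet_cap K1 (h1 I)) (facet_cap K2 (h2 I)).
(* The empty face is not the face of any simplex and is sent to the empty face; sets that are not
   faces also get [set0]. *)
have /choice [f fP] F : exists F', (F = set0 -> F' = set0) /\
    forall I, D I -> F = facet_cap G I -> F' = p I.
  have [->|F0] := EM (F = set0).
    exists set0; split=> // I DI E.
    by have [x] := facet_cap_neq0 DI; rewrite -E.
  have [[I DI FI]|nI] := EM (exists2 I, D I & F = facet_cap G I).
    exists (p I); split=> // J DJ; rewrite FI => /(facet_cap_inj simpleG DI DJ).
    by move=> ->.
  by exists set0; split=> // I DI FI; case: nI; exists I.
have f0 : f set0 = set0 by have [-> //] := fP set0.
have fE I : D I -> f (facet_cap G I) = p I by move=> DI;
  have [_ h] := fP (facet_cap G I); exact: h.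
have p_neq0 I : D I -> facet_cap K1 (h1 I) !=set0 /\ facet_cap K2 (h2 I) !=set0.
  by move=> DI; split; apply: facet_cap_neq0; [exact: D1|exact: D2].
have faceI F : face G F -> F = set0 \/ exists2 I, D I & F = facet_cap G I.
  move=> fF; have [->|/eqP/set0P F0] := EM (F = set0); first by left.
  by right; exact: face_facet_cap.
have h_sub I J : h1 J `<=` h1 I -> h2 J `<=` h2 I -> D J -> J `<=` I.
  move=> h1JI h2JI [JG _] s Js; have [Y1s|Y2s] := Y12_cover (JG _ Js).
    have [t [It Y1t] /inj1 <- //] : h1 I (g1 s) by apply: h1JI; exists s.
      exact: mem_set.
    exact: mem_set.
  have [t [It Y2t] /inj2 <- //] : h2 I (g2 s) by apply: h2JI; exists s.
    exact: mem_set.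
  exact: mem_set.
have fsub F F' : face G F -> face G F' -> F `<=` F' <-> f F `<=` f F'.
  move=> /faceI [->|[I DI ->]]; first by rewrite f0; split=> _ ? [].
  have [p1 p2] := p_neq0 I DI.
  move=> /faceI [->|[J DJ ->]]; rewrite fE // ?f0 ?fE //.
    split=> h; first by have [x /h] := facet_cap_neq0 DI.
    have [x1 x1I] := p1; have [x2 x2I] := p2.
    by have [] := h (row_mx x1 x2);
      rewrite /p /polyhedron_prod /= row_mxKl row_mxKr.
  rewrite prod_sub // (facet_cap_sub simpleG DI DJ).
  rewrite (facet_cap_sub simple1 (D1 _ DI) (D1 _ DJ)).
  rewrite (facet_cap_sub simple2 (D2 _ DI) (D2 _ DJ)).
  split=> [JI|[s1 s2]]; last exact: h_sub.
  by split; apply: image_subset => s [/JI].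
exists f; split=> //; last first.
  move=> F /faceI [->|[I DI ->]]; first by rewrite f0 !affdim_set0.
  rewrite fE //; have DI1 := (Dr1 _ DI).1; have DI2 := (Dr2 _ DI).1.
  rewrite affdim_prod; last 4 first.
  - by case: (simple_facet_cap simple1 (D1 _ DI)).
  - exact: (p_neq0 I DI).1.
  - by case: (simple_facet_cap simple2 (D2 _ DI)).
  - exact: (p_neq0 I DI).2.
  have [k1 I1k d1] := affdim_facet_cap simple1 (D1 _ DI).
  have [k2 I2k d2] := affdim_facet_cap simple2 (D2 _ DI).
  (* The codimension in [G] is computed in two stages, first to the part of [I] in [Y1] and then on
     to [I], to be compared with the codimensions in [K1] and [K2]. *)
  have [l1 I1l dl1] := affdim_facet_cap simpleG DI1.
  have [l2 I2l dl2] := affdim_facet_cap_sub simpleG DI1 DI (@subIsetl _ _ _).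
  have ID2 : I `\` (I `&` Y1) = I `&` Y2.
    apply/seteqP; split=> s.
      move=> [Is nIs]; split=> //; have [Y1s|//] := Y12_cover (DI.1 s Is).
      by case: nIs.
    move=> [Is Y2s]; split=> // -[_ Y1s].
    by have : (Y1 `&` Y2) s by []; rewrite Y12_disj.
  rewrite ID2 in I2l.
  have kl1 : k1 = l1.
    apply/card_eq_II; rewrite -(card_eql I1k); apply: card_eq_trans I1l.
    by apply: inj_card_eq => s t /[!inE] -[_ Ys] [_ Yt]; apply: inj1;
      rewrite inE.
  have kl2 : k2 = l2.
    apply/card_eq_II; rewrite -(card_eql I2k); apply: card_eq_trans I2l.
    by apply: inj_card_eq => s t /[!inE] -[_ Ys] [_ Yt]; apply: inj2;
      rewrite inE.
  move: dimG; rewrite dl1 dl2 d1 d2 kl1 kl2 => dd.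
  by apply: (addIr (l1%:Z + l2%:Z)); rewrite addrACA -dd addrA addrAC.
split.
- move=> F /faceI [->|[I DI ->]]; first by rewrite f0; exact: face_set0.
  by rewrite fE //; apply: face_prod; apply: facet_cap_face => //;
    [exact: D1|exact: D2].
- move=> F F' /[!inE] fF fF' FF'; apply/seteqP; split.
    by apply/(fsub F F') => //; rewrite FF'.
  by apply/(fsub F' F) => //; rewrite FF'.
- move=> E fE'; have [->|/eqP/set0P E0] := EM (E = set0).
    by exists set0 => //; exact: face_set0.
  have [F1 [F2 [fF1 fF2 F10 F20 ->]]] := prod_face fE' E0.
  have [J1 DJ1 ->] := face_facet_cap simple1 fF1 F10.
  have [J2 DJ2 ->] := face_facet_cap simple2 fF2 F20.
  pose I1 := [set s | Y1 s /\ J1 (g1 s)];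
    pose I2 := [set s | Y2 s /\ J2 (g2 s)].
  have J1E : g1 @` I1 = J1.
    apply/seteqP; split=> [_ [s [_ J1s] <-] //|t J1t].
    by have [s Ys st] := surj1 _ (DJ1.1 _ J1t); exists s => //; split;
      rewrite ?st.
  have J2E : g2 @` I2 = J2.
    apply/seteqP; split=> [_ [s [_ J2s] <-] //|t J2t].
    by have [s Ys st] := surj2 _ (DJ2.1 _ J2t); exists s => //; split;
      rewrite ?st.
  have DI1 : restrict D Y1 I1 by rewrite g1E ?J1E // => s [].
  have DI2 : restrict D Y2 I2 by rewrite g2E ?J2E // => s [].
  have DI := joinG DI1 DI2.
  have I1E : (I1 `|` I2) `&` Y1 = I1.
    apply/seteqP; split=> s; last by move=> I1s; split; [left|case: I1s].
    move=> [[//|[Y2s _]] Y1s].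
    by have : (Y1 `&` Y2) s by []; rewrite Y12_disj.
  have I2E : (I1 `|` I2) `&` Y2 = I2.
    apply/seteqP; split=> s; last by move=> I2s; split; [right|case: I2s].
    move=> [[[Y1s _]|//] Y2s].
    by have : (Y1 `&` Y2) s by []; rewrite Y12_disj.
  exists (facet_cap G (I1 `|` I2)); first exact: facet_cap_face.
  by rewrite fE // /p /h1 /h2 I1E I2E J1E J2E.
Qed.

End CombIso.

Lemma join_decomposition : G !=set0 ->
  exists m1 (K1 : set 'rV[R]_m1) m2 (K2 : set 'rV[R]_m2),
    [/\ simple_polyhedron K1 /\ complex_iso (restrict D Y1) (dual_complex K1),
        simple_polyhedron K2 /\ complex_iso (restrict D Y2) (dual_complex K2),
        Y2 = set0 -> is_point K2
      & comb_iso G (polyhedron_prod K1 K2)].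
Proof.
move=> G0.
have [N1 N1max] := maximal_simplex_restrict Y1 G0.
have [N2 N2max] := maximal_simplex_restrict Y2 G0.
have [[DN1 N1Y] N1max'] := N1max; have [[DN2 N2Y] N2max'] := N2max.
have link2 : link D N1 = restrict D Y2.
  apply: link_maximal_simplex N1max => //; first by rewrite setUC.
    by rewrite setIC.
  by move=> J1 J2 DJ1 DJ2; rewrite setUC; exact: joinG.
have iso1 := link_facet_cap simpleG DN2;
  rewrite (link_maximal_simplex Y12_cover Y12_disj joinG) // in iso1.
have iso2 := link_facet_cap simpleG DN1; rewrite link2 in iso2.
have simple1 := simple_facet_cap simpleG DN2.
have simple2' := simple_facet_cap simpleG DN1.
have [m2 [K2 [simple2 iso2' dim2]]] := pointed_model simple2' (facet_cap_neq0
  DN1).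
have vY2 : vertices (restrict D Y2) = Y2.
  by apply: vertices_restrict; rewrite vertices_dual.
(* The size of [N2] is the codimension of the face [K1] in [G]. Its image [N'] is a maximal simplex,
   so the same number is the dimension of the pointed [K2], and the dimensions add up to that of
   [G]. *)
have [||N' [DN' N'max] N'N2] := maximal_simplex_iso iso2 _ _ N2max.
- by move=> J [_]; rewrite vY2.
- by move=> J [+ _]; rewrite vertices_dual.
have [k N'k dK2] := dim2 N' DN' N'max.
have [l N2l dG] := affdim_facet_cap simpleG DN2.
have kl : k = l.
  apply/card_eq_II; rewrite -(card_eql N'k) -(card_eqr N2l).
  exact: N'N2.
have isoK2 := complex_iso_trans iso2 iso2'.
have K20 : K2 !=set0.
  have [f [_ fE]] := isoK2.
  have /fE : set0 `<=` vertices (restrict D Y2) by [].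
  rewrite image_set0 => -[/(_ _) [|_ [x [K2x _]]]]; last by exists x.
  by split=> //; exact: dual_complex0.
exists n, (facet_cap G N2), m2, K2; split=> //.
  move=> Y20; apply: affdim0_point => //; first by case: simple2.
  rewrite dK2; suff -> : k = 0%N by [].
  apply/card_eq_II; rewrite -(card_eql N'k) II0; apply: card_eq_trans N'N2 _.
  by rewrite card_eq0; apply/eqP; rewrite -subset0 -Y20.
apply: comb_iso_join => //.
by rewrite dG dK2 kl.
Qed.

End Join.
End JoinDecomposition.

(** * The link of a vertex of a nested complex *)

Section NestedComplexes.

Definition antichain (V : Type) (M : set (set V)) : Prop :=
  forall X Y, M X -> M Y -> X `<=` Y -> X = Y.

Definition union (V : Type) (M : set (set V)) : set V := \bigcup_(X in M) X.

(** Finite antichains replace indexed families: they can be mapped, cut down, or enlarged by one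
    element without reindexing. *)
Lemma nestedP (V : Type) (D B N : set (set V)) :
  nested_complex D B N <-> N `<=` B /\
    forall M, M `<=` N -> finite_set M -> antichain M ->
      (exists X Y, [/\ M X, M Y & X <> Y]) -> D (union M) /\ ~ B (union M).
Proof.
split=> -[NB H]; split=> //;
  [move=> M MN finM antiM [X [Y [MX MY XY]]]|move=> t x t2 Nx xanti].
  have [s0 sE0] := (finite_seqP M).1 finM.
  (* Enumerating [M] without repetition makes members at distinct indices distinct, hence
     incomparable. *)
  pose s := undup s0; pose x (i : 'I_(size s)) := nth set0 s i.
  have sE Z : M Z <-> Z \in s by rewrite mem_undup sE0.
  have -> : union M = \bigcup_i x i.
    apply/seteqP; split=> [v [Z MZ Zv]|v [i _ xv]].
      have Zs : (index Z s < size s)%N by rewrite index_mem; apply/sE.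
      by exists (Ordinal Zs) => //; rewrite /x nth_index //; apply/sE.
    by exists (x i) => //; apply/sE; exact: mem_nth.
  apply: H => [|i|i j ij xij].
  - have Xs : (index X s < size s)%N by rewrite index_mem; apply/sE.
    have Ys : (index Y s < size s)%N by rewrite index_mem; apply/sE.
    rewrite ltnNge; apply/negP => s1; apply: XY.
    rewrite -(nth_index set0 ((sE X).1 MX)) -(nth_index set0 ((sE Y).1 MY)).
    by move: Xs Ys s1; case: (size s) => [|[|?]] //;
      rewrite !ltnS !leqn0 => /eqP -> /eqP ->.
  - by apply: MN; apply/sE; exact: mem_nth.
  - have /eqP : x i = x j by apply: antiM xij; apply/sE; exact: mem_nth.
    by rewrite nth_uniq ?undup_uniq //; exact/negP.
have -> : \bigcup_i x i = union (range x).
  apply/seteqP; split=> [v [i _ xv]|v [_ [i _ <-] xv]]; last by exists i.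
  by exists (x i) => //; exists i.
apply: H => [_ [i _ <-] //|||].
- exact: finite_image.
- move=> _ _ [i _ <-] [j _ <-] xij; have [-> //|ij] := eqVneq i j.
  by case: (xanti _ _ ij xij).
- case: t t2 x Nx xanti => [|[|t]] // _ x Nx xanti.
  exists (x 0), (x 1); split; [by exists 0|by exists 1|].
  by move=> x01; apply: (xanti 0 1) => //; rewrite x01.
Qed.

Lemma nested_subsingleton (V : Type) (D B N : set (set V)) : N `<=` B ->
  (forall X Y, N X -> N Y -> X = Y) -> nested_complex D B N.
Proof.
move=> NB N1; apply/nestedP; split=> // M MN _ _ [X [Y [/MN NX /MN NY]]].
by case; exact: N1.
Qed.

Lemma vertices_nested (V : Type) (D B : set (set V)) :
  vertices (nested_complex D B) = B.
Proof.
apply/seteqP; split=> [X [+ _]|X BX]; first by apply.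
by apply: nested_subsingleton => [_ ->|_ _ -> ->].
Qed.

Lemma setU_setD (T : Type) (X Y : set T) : X `|` Y = Y `|` (X `\` Y).
Proof.
by rewrite -[LHS](@setDUK _ Y) ?setDUl ?setDv ?setU0 //; exact: subsetUr.
Qed.

Section Link.
Variables (V : Type) (D B : set (set V)) (S : set V).
Hypothesis Dsub : forall I J, D I -> J `<=` I -> D J.
Hypotheses (buildB : building_set D B) (BS : B S).

(** The condition [~ T <= S] keeps the trace nonempty, and [D (T | S)] puts it in the link of
    [S]. *)
Definition contraction : set (set V) :=
  [set T `\` S | T in [set T | [/\ B T, ~ T `<=` S & D (T `|` S)]]].

(** For nonempty [S], the boundary of the simplex with vertex set [S]. *)
Definition proper_faces : set (set V) := [set T | T `<=` S /\ T <> S].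

Definition restriction : set (set V) := B `&` proper_faces.

Lemma building_neq0 X : B X -> X !=set0.
Proof. by case: buildB => _ B0 _ _ BX; apply/set0P/eqP => X0;
  rewrite X0 in BX. Qed.

Lemma building_contraction : building_set (link D S) contraction.
Proof.
have [BD B0 B1 BU] := buildB; split.
- move=> _ [T [BT TS DTS] <-]; split; last by rewrite setDE;
  apply: Dsub DTS _ => v [[]|]; [left|right].
  by apply/seteqP; split=> v // [[_ nS]].
- by move=> [T [BT TS DTS] /seteqP [TS0 _]]; apply: TS;
  rewrite -setD_eq0 -subset0.
- move=> s [sS Ds]; exists [set s]; last first.
    apply/seteqP; split=> [v []|_ ->] //; split=> // Ss.
    by have : ([set s] `&` S) s by []; rewrite sS.
  split=> //; first by apply: B1; apply: Dsub Ds _; exact: subsetUl.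
  by move=> /(_ s erefl) Ss; have : ([set s] `&` S) s by []; rewrite sS.
- move=> _ _ [T [BT TS DTS] <-] [T' [BT' TS' DTS'] <-] [v [[Tv vS] [T'v _]]] [_
  DD].
  have DU : D (T `|` T' `|` S).
    apply: Dsub DD _ => w; have [Sw|nSw] := EM (S w); first by right.
    by move=> [[Tw|Tw]|//]; left; [left|right].
  exists (T `|` T'); last by rewrite setDUl.
  split=> //; last by move=> h; apply: TS => w Tw; apply: h; left.
  by apply: BU => //; [exists v|apply: Dsub DU _; exact: subsetUl].
Qed.

Lemma building_restriction : building_set proper_faces restriction.
Proof.
have [BD B0 B1 BU] := buildB; split.
- by move=> X [].
- by move=> [].
- move=> s Ds; split=> //; apply: B1; apply: Dsub (BD _ BS) _.
  by case: Ds.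
- move=> X Y [BX _] [BY _] XY DXY; split=> //; apply: BU => //.
  by apply: Dsub (BD _ BS) _; case: DXY.
Qed.

(** The elements of the building set compatible with [S] and not below it. *)
Definition outside : set (set V) :=
  [set T | B T /\ ((S `<=` T /\ T <> S) \/
    [/\ T `&` S = set0, D (T `|` S) & ~ B (T `|` S)])].

Lemma outside_not_sub T : outside T -> ~ T `<=` S.
Proof.
move=> [BT [[ST TS] sTS|[TS _ _] sTS]]; first by apply: TS; apply/seteqP.
have [v Tv] := building_neq0 BT.
by have Sv := sTS v Tv; have : (T `&` S) v by []; rewrite TS.
Qed.

Lemma outside_D T : outside T -> D (T `|` S).
Proof.
have [BD _ _ _] := buildB.
move=> [BT [[ST _]|[_ DTS _]]]; last by [].
by rewrite setUidl //; exact: BD.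
Qed.

Lemma outside_contraction T : outside T -> contraction (T `\` S).
Proof.
move=> oT; exists T => //; split; [by case: oT|exact: outside_not_sub|].
exact: outside_D.
Qed.

Lemma building_touch X : B X -> X `&` S !=set0 -> D (X `|` S) -> B (X `|` S).
Proof. by case: buildB => _ _ _ BU BX XS; exact: BU. Qed.

(** The delicate case is [T] containing [S] with [T'] disjoint from [S]. Then [T] and [T'] overlap
    outside [S] and their union is that of [T'] and [S], which would therefore be in [B], contrary
    to [outside T']. *)
Lemma outside_sub T T' : outside T -> outside T' -> T `\` S `<=` T' `\` S -> T
  `<=` T'.
Proof.
move=> oT oT' TT'; have [BT [[ST TS]|[TS _ _]]] := oT; last first.
  by move=> v Tv; case: (TT' v) => //; split=> // Sv; have : (T `&` S) v by [];
    rewrite TS.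
have [BT' [[ST' _]|[T'S D' nB']]] := oT'.
  by move=> v Tv; have [/ST' //|nSv] := EM (S v); case: (TT' v).
case: nB'; have /existsNP [v /not_implyP [Tv nSv]] := outside_not_sub oT.
have [T'v _] := TT' v (conj Tv nSv).
have -> : T' `|` S = T `|` T'.
  apply/seteqP; split=> w; first by case=> [|/ST]; [right|left].
  case=> [Tw|]; last by left.
  by have [|nSw] := EM (S w); [right|left; case: (TT' w)].
case: buildB => _ _ _ BU; apply: BU => //; first by exists v.
apply: Dsub D' _ => w; case=> [Tw|]; last by left.
by have [|nSw] := EM (S w); [right|left; case: (TT' w)].
Qed.

Lemma outside_inj T T' : outside T -> outside T' -> T `\` S = T' `\` S -> T =
  T'.
Proof.
by move=> oT oT' TT'; apply/seteqP; split; apply: outside_sub; rewrite ?TT'.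
Qed.

(** The representative is the union of [T] and [S] if that is in [B]. Otherwise it is [T], which
    must be disjoint from [S], as overlapping elements of [B] would have their union in [B]. *)
Lemma contraction_outside U : contraction U -> exists2 T, outside T & T `\` S =
  U.
Proof.
move=> [T [BT TS DTS] <-]; have [BTS|nBTS] := EM (B (T `|` S)).
  exists (T `|` S); last by rewrite setDUl setDv setU0.
  split=> //; left; split; first exact: subsetUr.
  by move=> h; apply: TS; rewrite -h; exact: subsetUl.
exists T => //; split=> //; right; split=> //.
apply/eqP/negPn/negP => /set0P TS0; apply: nBTS; exact: building_touch.
Qed.

Lemma union_setD M : union M `\` S = union ((fun T => T `\` S) @` M).
Proof.
apply/seteqP; split=> [v [[T MT Tv] nSv]|v [_ [T MT <-] [Tv nSv]]].
  by exists (T `\` S) => //; exists T.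
by split=> //; exists T.
Qed.

Lemma contraction_of_union Z : B Z \/ B (Z `|` S) -> D (Z `|` S) -> ~ Z `<=` S
  ->
  contraction (Z `\` S).
Proof.
move=> [BZ|BZ] DZ nZS; first by exists Z.
exists (Z `|` S); last by rewrite setDUl setDv setU0.
by split=> //; [move=> h; apply: nZS => v Zv; apply: h;
  left|rewrite -setUA setUid].
Qed.

Section Simplex.
Variable N : set (set V).

(** The union of an antichain below [S] is in [S] but not in [B]; since [S] is in [B], the union is
    a proper face. *)
Lemma nested_below : nested_complex D B (N `|` [set S]) ->
  nested_complex proper_faces restriction (N `&` restriction).
Proof.
move=> /nestedP [NB nestN]; apply/nestedP;
  split=> [T [] //|M MN finM antiM two].
have [|DM nBM] := nestN M _ finM antiM two; first by move=> T /MN [NT _]; left.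
have MS : union M `<=` S by move=> v [T /MN [_ [_ [TS _]]] /TS].
split; last by move=> [].
by split=> // MS'; rewrite MS' in nBM.
Qed.

(** An antichain of traces lifts to an antichain [M] of [N], because [outside_inj] makes the lift
    unique. If the trace of its union were the trace of some [T] in [B], then the union of [M], or
    that union enlarged by [S], would be in [B]. *)
Lemma nested_above : nested_complex D B (N `|` [set S]) ->
  nested_complex (link D S) contraction ((fun T => T `\` S) @` (N `&` outside)).
Proof.
move=> /nestedP [NB nestN]; apply/nestedP.
split=> [_ [T [NT oT] <-]|M' M'N finM' antiM' [X' [Y' [MX' MY' XY']]]].
  exact: outside_contraction.
pose M := [set T | [/\ N T, outside T & M' (T `\` S)]].
have MM' : (fun T => T `\` S) @` M = M'.
  apply/seteqP; split=> [_ [T [_ _ ?] <-] //|U MU].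
  by have [T [NT oT] TU] := M'N _ MU; exists T => //; split; rewrite ?TU.
have finM : finite_set M.
  suff /card_eqPle [_ /card_le_finite] : M' #= M by apply.
  rewrite -{1}MM'; apply: inj_card_eq => T T' /[!inE] -[_ oT _] [_ oT' _].
  exact: outside_inj.
have antiM : antichain M.
  move=> T T' [_ oT MT] [_ oT' MT'] TT'; apply: outside_inj => //.
  by apply: antiM' => // v [/TT'].
have [X MX XE] : exists2 X, M X & X `\` S = X' by rewrite -MM' in MX'.
have [Y MY YE] : exists2 Y, M Y & Y `\` S = Y' by rewrite -MM' in MY'.
have XY : X <> Y by move=> XY; apply: XY'; rewrite -XE XY.
have [||DM nBM] := nestN M _ finM antiM; first by move=> T [NT _ _]; left.
  by exists X, Y.
have [v [Xv nSv]] : exists v, (X `\` S) v.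
  case: MX => _ /outside_not_sub /existsNP [v /not_implyP [Xv nSv]] _.
  by exists v.
have XM : X `<=` union M by move=> w Xw; exists X.
(* If a member contains [S], so does the union; otherwise all members are disjoint from [S], and [S]
   can be adjoined to the antichain. *)
have [DMS nBMS] : D (union M `|` S) /\ ~ B (union M `|` S).
  have [[T MT ST]|noS] := EM (exists2 T, M T & S `<=` T).
    rewrite setUidl // => w /ST Tw; by exists T.
  have -> : union M `|` S = union (M `|` [set S]) by rewrite /union bigcup_setU
    bigcup_set1.
  have disj T : M T -> T `&` S = set0.
    move=> MT; have [_ [_ [[ST _]|[//]]] _] := MT.
    by case: noS; exists T.
  apply: nestN.
  - by move=> T [[NT _ _]|->]; [left|right].
  - by rewrite finite_setU; split=> //; exact: finite_set1.
  - move=> T T' [MT|->] [MT'|->] // TT'; first exact: antiM.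
      by have [_ /outside_not_sub] := MT.
    by case: noS; exists T'.
  - exists X, S; split; [by left|by right|].
    by move=> XS; apply: nSv; rewrite -XS.
rewrite -MM' -union_setD; split.
  split; first by apply/seteqP; split=> w // [[]].
  by rewrite setDE; apply: Dsub DMS _ => w [[]|]; [left|right].
move=> [T [BT nTS DTS] TE].
have TSE : T `|` S = union M `|` S.
  by rewrite setU_setD TE -setU_setD.
have [TS|/eqP/set0P TS] := EM (T `&` S = set0); last first.
  by apply: nBMS; rewrite -TSE; exact: building_touch.
have TE' : T = union M `\` S.
  rewrite -TE; apply/seteqP; split=> w; last by case.
  by move=> Tw; split=> // Sw; have : (T `&` S) w by []; rewrite TS.
(* Now [T] is the trace of the union. A member [Z] containing [S] overlaps [T], and together they
   make up the union of [M], with [S] included. *)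
have [[Z MZ SZ]|noS] := EM (exists2 T, M T & S `<=` T).
  apply: nBMS; rewrite -TSE.
  have ZT : T `|` S = T `|` Z.
    apply/seteqP; split=> w; first by case=> [|/SZ]; [left|right].
    case=> [|Zw]; first by left.
    by have [|nSw] := EM (S w); [right|left; rewrite TE'; split=> //; exists Z].
  rewrite ZT; case: buildB => _ _ _ BU; apply: BU => //.
  - by case: MZ => _ [].
  - have [_ /outside_not_sub /existsNP [w /not_implyP [Zw nSw]] _] := MZ.
    by exists w; split=> //; rewrite TE'; split=> //; exists Z.
  - by rewrite -ZT.
apply: nBM; suff <- : T = union M by [].
rewrite TE'; apply/seteqP; split=> w; first by case.
move=> [Z MZ Zw]; split; first by exists Z.
have [_ [_ [[SZ _]|[ZS _ _]]] _] := MZ; first by case: noS; exists Z.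
by move=> Sw; have : (Z `&` S) w by []; rewrite ZS.
Qed.

Hypothesis nest1 :
  nested_complex (link D S) contraction ((fun T => T `\` S) @` (N `&` outside)).
Hypothesis nest2 : nested_complex proper_faces restriction (N `&` restriction).

(** For at least two members, nestedness in the contraction gives the claims. It is silent on a
    single member, where they come from the definition of [outside]. *)
Lemma outside_union M : M `<=` N `&` outside -> finite_set M -> antichain M ->
  M !=set0 ->
  [/\ D (union M `|` S),
      (forall T, M T -> T `&` S = set0) -> ~ B (union M `|` S)
    & (exists X Y, [/\ M X, M Y & X <> Y]) -> ~ B (union M)].
Proof.
move=> MN finM antiM [T MT].
have nMS : ~ union M `<=` S.
  move=> h; have [_ /outside_not_sub] := MN _ MT; apply.
  by move=> v Tv; apply: h; exists T.
have [[X [Y [MX MY XY]]]|single] := EM (exists X Y, [/\ M X, M Y & X <> Y]).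
  have [_ nest] := (nestedP _ _ _).1 nest1.
  have [||||[_ DM] nC] := nest ((fun T => T `\` S) @` M).
  - by move=> _ [Z /MN NZ <-]; exists Z.
  - exact: finite_image.
  - move=> _ _ [Z MZ <-] [Z' MZ' <-] ZZ'; congr (_ `\` _); apply: antiM => //.
    by apply: outside_sub ZZ'; [case: (MN _ MZ)|case: (MN _ MZ')].
  - exists (X `\` S), (Y `\` S); split; [by exists X|by exists Y|].
    by move=> /outside_inj h; apply: XY; apply: h;
      [case: (MN _ MX)|case: (MN _ MY)].
  rewrite -union_setD in DM nC.
  have DMS : D (union M `|` S) by rewrite setU_setD setUC.
  by split=> // _ BM; apply: nC; apply: contraction_of_union => //;
    [right|left].
have ME : union M = T.
  apply/seteqP; split=> [v [Z MZ Zv]|v Tv]; last by exists T.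
  suff -> : T = Z by [].
  by apply: contrapT => TZ; apply: single; exists T, Z.
have [_ oT] := MN _ MT; rewrite ME; split=> //; first exact: outside_D.
move=> disj; have [_ [[ST _]|[]]] := oT => //.
have [v Sv] := building_neq0 BS.
by have Tv := ST v Sv; have : (T `&` S) v by []; rewrite disj.
Qed.

(** An antichain without members below [S] lies in [outside], and one without members in [outside]
    lies in [restriction]. In the mixed case a union in [B] would overlap [S] and absorb it, against
    [outside_union]. *)
Lemma nested_glue : N `<=` outside `|` restriction ->
  nested_complex D B (N `|` [set S]).
Proof.
move=> NX; apply/nestedP; split.
  by move=> T [/NX [[]|[]]|->].
move=> M MN finM antiM two.
have [BD _ _ _] := buildB; have DS := BD _ BS.
pose M1 := M `&` outside.
have finM1 : finite_set M1 by exact: finite_setIl.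
have antiM1 : antichain M1 by move=> X Y [MX _] [MY _]; exact: antiM.
have Mcases T : M T -> M1 T \/ T `<=` S.
  move=> MT; have [NT|->] := MN _ MT; last by right.
  have [oT|[_ []]] := NX _ NT; last by right.
  by left.
have notS T : outside T -> T <> S by move=> /outside_not_sub oT TS; apply: oT;
  rewrite TS.
have M1N : M1 `<=` N `&` outside.
  by move=> T [MT oT]; split=> //; have [//|/notS] := MN _ MT.
have [[E ME ES]|noE] := EM (exists2 E, M E & E `<=` S); last first.
  have M1E : M1 = M.
    apply/seteqP; split=> T; first by case.
    by move=> MT; have [//|TS] := Mcases _ MT; case: noE; exists T.
  rewrite M1E in M1N.
  have [|DM _ nBM] := outside_union M1N finM antiM;
    first by case: two => X [_ [? _ _]]; exists X.
  by split; [apply: Dsub DM _; exact: subsetUl|exact: nBM].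
have [e Ee] : E !=set0.
  apply: building_neq0; have [/NX [[]|[]]|->] := MN _ ME => //.
(* An outside member containing [S] would contain [E], which the antichain condition forbids. *)
have disj T : M1 T -> T `&` S = set0.
  move=> [MT oT]; have [_ [[ST _]|[]]] := oT => //.
  have ET : E = T by apply: antiM => // v /ES /ST.
  by case: (outside_not_sub oT); rewrite -ET.
have [M10|/set0P/negP/negPn/eqP M10] := EM (M1 !=set0).
  have [DM nBM _] := outside_union M1N finM1 antiM1 M10.
  have sub : union M `<=` union M1 `|` S.
    move=> v [T MT Tv]; have [M1T|TS] := Mcases _ MT; last by right; exact: TS.
    by left; exists T.
  have MSE : union M `|` S = union M1 `|` S.
    apply/seteqP; split=> v [|]; [exact: sub|by right| |by right].
    by move=> [T [MT _] Tv]; left; exists T.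
  split; first exact: Dsub DM sub.
  move=> BM; apply: (nBM disj); rewrite -MSE; apply: building_touch => //.
    by exists e; split; [exists E|exact: ES].
  by rewrite MSE.
have MS T : M T -> T `<=` S.
  by move=> MT; have [|//] := Mcases _ MT; rewrite M10.
have MN2 : M `<=` N `&` restriction.
  move=> T MT; have [NT|TS] := MN _ MT.
    split=> //; have [oT|//] := NX _ NT.
    by case: (outside_not_sub oT); exact: MS.
  (* If [S] itself is a member, every other member lies below it, so the antichain has only one
     element. *)
  case: two => X [Y [MX MY []]]; rewrite TS in MT.
  by rewrite (antiM _ _ MX MT (MS _ MX)) (antiM _ _ MY MT (MS _ MY)).
have [_ nest] := (nestedP _ _ _).1 nest2.
have [[MS' MnS] nBM] := nest M MN2 finM antiM two.
by split=> [|BM]; [exact: Dsub DS MS'|apply: nBM].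
Qed.

End Simplex.

(** When [T] and [S] are incomparable, nestedness applies to this pair; [T] then misses [S], since
    otherwise their union would be in [B]. *)
Lemma nested_cases N T : nested_complex D B (N `|` [set S]) -> N T -> T <> S ->
  outside T \/ restriction T.
Proof.
move=> /nestedP [NB nestN] NT TS; have BT : B T by apply: NB; left.
have [sTS|nTS] := EM (T `<=` S); first by right.
left; split=> //; have [sST|nST] := EM (S `<=` T); first by left.
have [||||] := nestN [set T; S].
- by move=> _ [->|->]; [left|right].
- exact: finite_set2.
- by move=> _ _ [->|->] [->|->].
- by exists T, S; split=> //; [left|right].
rewrite /union bigcup_setU !bigcup_set1 => DTS nBTS; right; split=> //.
by apply/eqP/negPn/negP => /set0P TS0; apply: nBTS; exact: building_touch.
Qed.

Lemma vertices_link_nested :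
  vertices (link (nested_complex D B) [set S]) = outside `|` restriction.
Proof.
apply/seteqP; split=> T.
  move=> [TS nestT]; apply: (nested_cases nestT) => // TS'.
  by have : ([set T] `&` [set S]) S by []; rewrite TS.
move=> oT; split.
  apply/seteqP; split=> // X [-> TS]; case: oT; rewrite TS.
    by move/outside_not_sub; apply.
  by case=> _ [].
apply: nested_glue; last by move=> _ ->.
  apply: nested_subsingleton; first by move=> _ [X [_ oX] <-];
    exact: outside_contraction.
  by move=> _ _ [X [-> _] <-] [Y [-> _] <-].
by apply: nested_subsingleton => [X []//|X Y [-> _] [-> _]].
Qed.

Lemma link_nested_complex :
  complex_iso (link (nested_complex D B) [set S])
    (complex_join (nested_complex (link D S) contraction)
       (nested_complex proper_faces restriction)).
Proof.
pose p T : set V + set V := if `[< T `<=` S >] then inr T else inl (T `\` S).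
have pout T : outside T -> p T = inl (T `\` S).
  by move=> /outside_not_sub oT; rewrite /p; case: asboolP.
have pin T : restriction T -> p T = inr T.
  by move=> [_ [TS _]]; rewrite /p; case: asboolP.
have vinl U : vertices (complex_join (nested_complex (link D S) contraction)
       (nested_complex proper_faces restriction)) (inl U) <-> contraction U.
  rewrite -[contraction in X in _ <-> X](vertices_nested (link D S)).
  rewrite /vertices /complex_join /=.
  have -> : [set v | [set inl U] (inl v : set V + set V)] = [set U].
    by apply/seteqP; split=> [v [->]|_ ->].
  split=> [[] //|cU]; split=> //.
  by apply: nested_subsingleton => [v|v w].
have vinr U : vertices (complex_join (nested_complex (link D S) contraction)
       (nested_complex proper_faces restriction)) (inr U) <-> restriction U.
  rewrite -[restriction in X in _ <-> X](vertices_nested proper_faces).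
  rewrite /vertices /complex_join /=.
  have -> : [set v | [set inr U] (inr v : set V + set V)] = [set U].
    by apply/seteqP; split=> [v [->]|_ ->].
  split=> [[] //|cU]; split=> //.
  by apply: nested_subsingleton => [v|v w].
exists p; rewrite vertices_link_nested; split.
  split.
  - move=> T [oT|rT]; first by rewrite pout //; apply/vinl;
    exact: outside_contraction.
    by rewrite pin //; exact/vinr.
  - move=> T T' /[!inE] -[oT|rT] [oT'|rT'].
    + by rewrite !pout // => -[]; exact: outside_inj.
    + by rewrite pout // pin.
    + by rewrite pin // pout.
    + by rewrite !pin // => -[].
  - move=> [U /vinl /contraction_outside [T oT <-]|U /vinr rU].
      by exists T; [left|exact: pout].
    by exists U; [right|exact: pin].
move=> I IX.
have SI : I `&` [set S] = set0.
  apply/seteqP; split=> // T [IT TS]; rewrite TS in IT.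
  case: (IX _ IT); first by move/outside_not_sub; apply.
  by case=> _ [].
have -> : complex_join (nested_complex (link D S) contraction)
    (nested_complex proper_faces restriction) (p @` I) =
    (nested_complex (link D S) contraction ((fun T => T `\` S) @` (I `&`
      outside)) /\
    nested_complex proper_faces restriction (I `&` restriction)).
  congr (_ /\ _).
    congr (nested_complex _ _ _); apply/seteqP; split=> U.
      move=> [T IT]; have [oT|rT] := IX _ IT; last by rewrite pin.
      by rewrite pout // => -[<-]; exists T.
    by move=> [T [IT oT] <-]; exists T; rewrite ?pout.
  congr (nested_complex _ _ _); apply/seteqP; split=> U.
    move=> [T IT]; have [oT|rT] := IX _ IT; first by rewrite pout.
    by rewrite pin // => -[<-].
  by move=> [IU rU]; exists U; rewrite ?pin.
split=> [[_ nestI]|[n1 n2]]; first by split;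
  [exact: nested_above|exact: nested_below].
by split=> //; exact: nested_glue.
Qed.

End Link.
End NestedComplexes.

(** * Transport of building sets and links along isomorphisms *)

Section Transport.
Variables (V W : Type) (D : set (set V)) (E : set (set W)).
Hypotheses (DV : forall I, D I -> I `<=` vertices D).
Hypotheses (EV : forall I, E I -> I `<=` vertices E).

(** [C] consists of the images of the members of [B]. Images commute with unions, and injectivity on
    vertices lets inclusions and membership be pulled back. *)
Lemma nested_complex_iso B : building_set D B -> complex_iso D E ->
  exists2 C, building_set E C & complex_iso (nested_complex D B)
    (nested_complex E C).
Proof.
move=> [BD B0 B1 BU] [f [[fun_f inj_f surj_f] fE]].
have f_sub X Y : X `<=` vertices D -> Y `<=` vertices D -> f @` X `<=` f @` Y
  -> X `<=` Y.
  move=> XD YD XY v Xv; have [|w Yw /inj_f <- //] := XY (f v);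
    first by exists v.
    by rewrite inE; exact: YD.
  by rewrite inE; exact: XD.
have f_inj X Y : X `<=` vertices D -> Y `<=` vertices D -> f @` X = f @` Y -> X
  = Y.
  by move=> XD YD XY; apply/seteqP; split; apply: f_sub => //; rewrite XY.
have BV X : B X -> X `<=` vertices D by move=> /BD /DV.
pose C := (fun X => f @` X) @` B.
have CE X : X `<=` vertices D -> C (f @` X) <-> B X.
  move=> XD; split=> [[Y BY /f_inj <- //]|BX]; [exact: BV|by exists X].
exists C.
  split.
  - by move=> _ [X BX <-]; apply/fE; [exact: BV|exact: BD].
  - by move=> [X BX] /image_set0_set0 X0; rewrite X0 in BX.
  - move=> _ /surj_f [v Dv <-]; exists [set v]; [exact: B1|exact: image_set1].
  - move=> _ _ [X BX <-] [Y BY <-] [_ [[v Xv <-] [w Yw fwv]]];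
    rewrite -image_setU.
    have XYD : X `|` Y `<=` vertices D by move=> u [/BV|/BV]; [exact|exact].
    move=> /fE DXY; apply/CE => //; apply: BU => //; last exact: DXY.
    exists v; split=> //; suff <- : w = v by [].
    by apply: inj_f fwv; rewrite inE; [exact: BV Yw|exact: BV Xv].
exists (fun X => f @` X); rewrite !vertices_nested; split.
  split=> [X BX|X Y /[!inE] BX BY|_ [X BX <-]].
  - by exists X.
  - by apply: f_inj; exact: BV.
  - by exists X.
move=> N NB; split=> -[_ nestN].
  split=> [_ [X /NB BX <-]|t y t2 yN yanti]; first by exists X.
  have /choice [x xP] i : exists X, N X /\ f @` X = y i by have [X NX Xy] := yN
    i; exists X.
  have yE : y = fun i => f @` (x i) by apply/funext => i; case: (xP i).
  have UV : \bigcup_i x i `<=` vertices D.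
    by move=> v [i _ xv]; apply: BV xv; apply: NB; case: (xP i).
  have -> : \bigcup_i y i = f @` (\bigcup_i x i) by rewrite yE image_bigcup.
  have [|i j ij xij|DU nBU] := nestN t x t2.
  - by move=> i; case: (xP i).
  - by apply: (yanti i j ij); rewrite yE; exact: image_subset.
  - by split; [exact/fE|move/CE => /(_ UV)].
split=> // t x t2 xN xanti.
have UV : \bigcup_i x i `<=` vertices D.
  by move=> v [i _ xv]; apply: BV xv; apply: NB.
have [|i j ij fxij|] := nestN t (fun i => f @` (x i)) t2.
- by move=> i; exists (x i).
- by apply: (xanti i j ij); apply: f_sub fxij; apply: BV; exact: NB.
- rewrite -image_bigcup => EU nCU; split; first exact/fE.
  by move=> /CE => /(_ UV).
Qed.

Lemma link_set1_iso (f : V -> W) v : set_bij (vertices D) (vertices E) f ->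
  (forall I, I `<=` vertices D -> (D I <-> E (f @` I))) -> vertices D v ->
  complex_iso (link D [set v]) (link E [set f v]).
Proof.
move=> [fun_f inj_f surj_f] fE Dv.
have vD u : vertices (link D [set v]) u <-> u <> v /\ D [set u; v].
  split=> -[h Duv]; split=> //; last by apply/seteqP; split=> // x [-> /h].
  by move=> uv; have : ([set u] `&` [set v]) u by []; rewrite h.
have vE u : vertices (link E [set f v]) u <-> u <> f v /\ E [set u; f v].
  split=> -[h Duv]; split=> //; last by apply/seteqP; split=> // x [-> /h].
  by move=> uv; have : ([set u] `&` [set f v]) u by []; rewrite h.
have vDV u : vertices (link D [set v]) u -> vertices D u.
  by move=> /vD [_ /DV]; apply; left.
have fneq u : vertices D u -> f u = f v -> u = v.
  by move=> Du /inj_f; apply; rewrite inE.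
have pairE u : vertices D u -> D [set u; v] <-> E [set f u; f v].
  move=> Du; rewrite fE; last by move=> x [|] ->.
  by rewrite image_setU !image_set1.
exists f; split.
  split=> [u uL|u w /[!inE] /vDV Du /vDV Dw|w /vE [wv Ew]].
  - have Du := vDV _ uL; have [uv Duv] := (vD u).1 uL.
    by apply/vE; split; [move/(fneq _ Du)|exact/pairE].
  - by apply: inj_f; rewrite inE.
  - have /surj_f [u Du uw] : vertices E w by apply: (EV Ew); left.
    exists u => //; apply/vD; split; first by move=> uv; apply: wv;
      rewrite -uw uv.
    by apply/pairE; rewrite ?uw.
move=> J JL.
have JD : J `|` [set v] `<=` vertices D by move=> u [/JL /vDV|->].
have Jv : J `&` [set v] = set0.
  by apply/seteqP; split=> // u [/JL /vD [uv _] /uv].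
have fJv : f @` J `&` [set f v] = set0.
  apply/seteqP; split=> // _ [[u Ju <-] fuv].
  by have /vD [uv _] := JL _ Ju; apply: uv; apply: fneq => //;
    exact: vDV (JL _ Ju).
by rewrite /link /mkset Jv fJv fE // image_setU image_set1; split=> -[_ EJ].
Qed.

End Transport.

(** * Decomposition along an abstract join *)

Section JoinNestohedra.
Variables (R : realFieldType) (n : nat) (G : set 'rV[R]_n).
Variables (V1 V2 : Type) (E1 : set (set V1)) (E2 : set (set V2)).
Variables (v1 : V1) (v2 : V2).

Lemma join_iso_decomposition : simple_polyhedron G -> G !=set0 ->
  complex_iso (dual_complex G) (complex_join E1 E2) ->
  exists m1 (K1 : set 'rV[R]_m1) m2 (K2 : set 'rV[R]_m2),
    [/\ simple_polyhedron K1 /\ complex_iso (dual_complex K1) E1,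
        simple_polyhedron K2 /\ complex_iso (dual_complex K2) E2,
        (forall v, ~ E2 [set v]) -> is_point K2
      & comb_iso G (polyhedron_prod K1 K2)].
Proof.
move=> simpleG G0 [h []]; rewrite vertices_dual => -[fun_h inj_h surj_h] hE.
pose Y1 := [set s | facet G s /\ exists v, h s = inl v].
pose Y2 := [set s | facet G s /\ exists v, h s = inr v].
have Y1G : Y1 `<=` facet G by move=> s [].
have Y2G : Y2 `<=` facet G by move=> s [].
have cover : facet G `<=` Y1 `|` Y2.
  by move=> s Gs; case E : (h s) => [v|v]; [left|right]; split=> //; exists v.
have disj : Y1 `&` Y2 = set0.
  by apply/seteqP; split=> // s [[_ [v hs]] [_ [w]]]; rewrite hs.
have [E10 E20] : E1 set0 /\ E2 set0.
  have /(hE _ (sub0set _)) [] := dual_complex0 G0; rewrite image_set0.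
  by rewrite (_ : [set v | set0 (inl v)] = set0) // (_ : [set v | set0 (inr v)]
    = set0).
(* The points [v1] and [v2] make the two halves of [h] total functions. *)
pose p1 s := if h s is inl v then v else v1.
pose p2 s := if h s is inr v then v else v2.
have part1 J1 J2 : J1 `<=` Y1 -> J2 `<=` Y2 ->
    [set v | (h @` (J1 `|` J2)) (inl v)] = p1 @` J1.
  move=> J1Y J2Y; apply/seteqP;
    split=> [v [s [J1s|/J2Y [_ [w ->]] //] hs]|_ [s J1s <-]].
    by exists s => //; rewrite /p1 hs.
  by exists s; [left|rewrite /p1; have [_ [v ->]] := J1Y _ J1s].
have part2 J1 J2 : J1 `<=` Y1 -> J2 `<=` Y2 ->
    [set v | (h @` (J1 `|` J2)) (inr v)] = p2 @` J2.
  move=> J1Y J2Y; apply/seteqP;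
    split=> [v [s [/J1Y [_ [w ->]] //|J2s] hs]|_ [s J2s <-]].
    by exists s => //; rewrite /p2 hs.
  by exists s; [right|rewrite /p2; have [_ [v ->]] := J2Y _ J2s].
have DE J1 J2 : J1 `<=` Y1 -> J2 `<=` Y2 ->
    dual_complex G (J1 `|` J2) <-> E1 (p1 @` J1) /\ E2 (p2 @` J2).
  move=> J1Y J2Y; rewrite hE; last by move=> s [/J1Y|/J2Y] [].
  by rewrite /complex_join /mkset -(part1 _ _ J1Y J2Y) -(part2 _ _ J1Y J2Y).
have DE1 J : J `<=` Y1 -> dual_complex G J <-> E1 (p1 @` J).
  move=> JY; rewrite -[J in dual_complex _ J]setU0 (DE J set0 JY (sub0set _)).
  by rewrite image_set0; split=> [[]|].
have DE2 J : J `<=` Y2 -> dual_complex G J <-> E2 (p2 @` J).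
  move=> JY; rewrite -[J in dual_complex _ J]set0U (DE set0 J (sub0set _) JY).
  by rewrite image_set0; split=> [[]|].
have joinG J1 J2 : restrict (dual_complex G) Y1 J1 ->
    restrict (dual_complex G) Y2 J2 -> dual_complex G (J1 `|` J2).
  by move=> [D1 J1Y] [D2 J2Y]; apply/DE => //; split; [exact/DE1|exact/DE2].
have vY1 : vertices (restrict (dual_complex G) Y1) = Y1.
  by apply: vertices_restrict; rewrite vertices_dual.
have vY2 : vertices (restrict (dual_complex G) Y2) = Y2.
  by apply: vertices_restrict; rewrite vertices_dual.
have vinl v : vertices (complex_join E1 E2) (inl v) <-> vertices E1 v.
  rewrite /vertices /complex_join /mkset.
  rewrite (_ : (fun w => inl w = inl v) = [set v]); last first.
    by apply/seteqP; split=> [w []|_ ->].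
  rewrite (_ : (fun w => inr w = inl v) = set0); last by apply/seteqP; split.
  by split=> [[]|].
have vinr v : vertices (complex_join E1 E2) (inr v) <-> vertices E2 v.
  rewrite /vertices /complex_join /mkset.
  rewrite (_ : (fun w => inr w = inr v) = [set v]); last first.
    by apply/seteqP; split=> [w []|_ ->].
  rewrite (_ : (fun w => inl w = inr v) = set0); last by apply/seteqP; split.
  by split=> [[]|].
have iso1 : complex_iso (restrict (dual_complex G) Y1) E1.
  exists p1; rewrite vY1; split; last first.
    by move=> J JY; rewrite -DE1 //; split=> [[]|].
  split=> [s [Gs [v hs]]|s t /[!inE] -[Gs [v hs]] [Gt [w ht]]|v /vinl /surj_h
    [s Gs hs]].
  - by rewrite /p1 hs; apply/vinl; rewrite -hs; exact: fun_h.
  - rewrite /p1 hs ht => vw; apply: inj_h; rewrite ?inE // hs ht vw //.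
  - by exists s; [split=> //; exists v|rewrite /p1 hs].
have iso2 : complex_iso (restrict (dual_complex G) Y2) E2.
  exists p2; rewrite vY2; split; last first.
    by move=> J JY; rewrite -DE2 //; split=> [[]|].
  split=> [s [Gs [v hs]]|s t /[!inE] -[Gs [v hs]] [Gt [w ht]]|v /vinr /surj_h
    [s Gs hs]].
  - by rewrite /p2 hs; apply/vinr; rewrite -hs; exact: fun_h.
  - rewrite /p2 hs ht => vw; apply: inj_h; rewrite ?inE // hs ht vw //.
  - by exists s; [split=> //; exists v|rewrite /p2 hs].
have [m1 [K1 [m2 [K2 [[simple1 isoK1] [simple2 isoK2] pt GK]]]]] :=
  join_decomposition simpleG Y1G Y2G cover disj joinG G0.
exists m1, K1, m2, K2; split=> //.
- by split=> //; apply: complex_iso_trans (complex_iso_sym set0 isoK1) iso1.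
- by split=> //; apply: complex_iso_trans (complex_iso_sym set0 isoK2) iso2.
- move=> E2v; apply: pt; apply/seteqP; split=> // s [Gs [v hs]].
  by apply: (E2v v); apply/vinr; rewrite -hs; exact: fun_h.
Qed.

End JoinNestohedra.

(** * The simplex *)

Section StandardSimplex.
Variable R : realFieldType.

Lemma point_no_facet n (P F : set 'rV[R]_n) : is_point P -> ~ facet P F.
Proof.
move=> [x Px] [/face_sub FP [y Fy] dF].
have FE : F = P.
  apply/seteqP; split=> // z; rewrite Px => ->.
  by have := FP _ Fy; rewrite Px => <-.
move: dF; rewrite FE => /eqP; rewrite -subr_eq0 opprD addNKr.
by rewrite oppr_eq0 oner_eq0.
Qed.

(** The values of the columns of this matrix on a vector are the families of
    [d.+1] scalars with sum [0]. *)
Definition simplex_mx d : 'M[R]_(d, d.+1) :=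
  \matrix_(p, i) if unlift ord0 i is Some j then (p == j)%:R else -1.

Lemma simplex_mx_lift d (u : 'rV[R]_d) j : (u *m simplex_mx d) 0 (lift ord0 j)
  = u 0 j.
Proof.
rewrite mxE (bigD1 j) //= mxE liftK eqxx mulr1 big1 ?addr0 // => p pj.
by rewrite mxE liftK (negbTE pj) mulr0.
Qed.

Lemma simplex_mx0 d (u : 'rV[R]_d) : (u *m simplex_mx d) 0 ord0 = - \sum_j u 0
  j.
Proof.
rewrite mxE -sumrN; apply: eq_bigr => p _.
by rewrite mxE unlift_none mulrN1.
Qed.

Lemma simplex_mx_sum d (u : 'rV[R]_d) : \sum_i (u *m simplex_mx d) 0 i = 0.
Proof.
rewrite big_ord_recl simplex_mx0 addrC.
by under eq_bigr do rewrite simplex_mx_lift; rewrite subrr.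
Qed.

Lemma simplex_mx_surj d (t : 'I_d.+1 -> R) : \sum_i t i = 0 ->
  exists u : 'rV_d, forall i, (u *m simplex_mx d) 0 i = t i.
Proof.
rewrite big_ord_recl => /eqP; rewrite addr_eq0 => /eqP t0.
exists (\row_j t (lift ord0 j)) => i; case: (unliftP ord0 i) => [j|] ->.
  by rewrite simplex_mx_lift mxE.
by rewrite simplex_mx0 t0; congr (- _); apply: eq_bigr => j _; rewrite mxE.
Qed.

Lemma simplex_hpoly d : simplex (hpoly (simplex_mx d) (fun=> 1)).
Proof.
(* At the vertex [v i] every constraint except the [i]-th is active; the [i]-th takes the value
   [- d]. *)
pose v (i : 'I_d.+1) : 'rV[R]_d := \row_j (1 - (d.+1)%:R * (i == lift ord0
  j)%:R).
have sumE (l : 'I_d.+1 -> R) j :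
    (\sum_i l i *: v i) 0 j = \sum_i l i - (d.+1)%:R * l (lift ord0 j).
  rewrite summxE.
  under eq_bigr do rewrite !mxE mulrBr mulr1.
  rewrite sumrB; congr (_ - _).
  rewrite (bigD1 (lift ord0 j)) //= eqxx mulr1 mulrC big1 ?addr0 // => i ij.
  by rewrite (negbTE ij) !mulr0.
have dn0 : (d.+1)%:R != 0 :> R by rewrite pnatr_eq0.
exists d, v; split.
  move=> l l0 lv.
  have lj j : l (lift ord0 j) = 0.
    have /rowP /(_ j) := lv; rewrite sumE l0 sub0r mxE => /eqP.
    by rewrite oppr_eq0 mulf_eq0 (negbTE dn0) => /eqP.
  move=> i; case: (unliftP ord0 i) => [j|] -> //.
  by move: l0; rewrite big_ord_recl big1 ?addr0.
apply/seteqP; split=> [u Qu|_ [l [l_ge0 l1 ->]] i].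
  (* The barycentric coordinates of [u] are its slacks divided by [d.+1], which is their sum. *)
  exists (fun i => (1 - (u *m simplex_mx d) 0 i) / (d.+1)%:R).
  have S1 : \sum_i (1 - (u *m simplex_mx d) 0 i) / (d.+1)%:R = 1.
    by rewrite -mulr_suml sumrB simplex_mx_sum subr0 sumr_const card_ord divff.
  split=> // [i|]; first by rewrite divr_ge0 ?subr_ge0.
  apply/rowP => j; rewrite sumE S1 mulrC divfK // simplex_mx_lift.
  by rewrite opprB addrC subrK.
have le1 j : l j <= 1.
  by rewrite -l1 (bigD1 j) //= lerDl sumr_ge0.
case: (unliftP ord0 i) => [j|] ->.
  rewrite simplex_mx_lift sumE l1 gerDl oppr_le0.
  by rewrite mulr_ge0.
rewrite simplex_mx0; under eq_bigr do rewrite sumE l1.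
rewrite sumrB sumr_const card_ord -mulr_sumr.
move: l1; rewrite big_ord_recl => l1.
have -> : \sum_j l (lift ord0 j) = 1 - l ord0 by rewrite -l1 addrC addKr.
have := l_ge0 ord0; have : 0 <= (d.+1)%:R * l ord0 by rewrite mulr_ge0.
by rewrite -natr1; lra.
Qed.

(** The values of the [d.+1] constraints sum to 0, so they cannot all be 1. If [i0] is exempt, the
    value [- d] there balances the ones elsewhere. *)
Lemma simplex_active d (A : {set 'I_d.+1}) :
  (exists2 u, hpoly (simplex_mx d) (fun=> 1) u &
     A \subset active (simplex_mx d) (fun=> 1) u) <-> A != finset.setT.
Proof.
split=> [[u _ /fintype.subsetP Au]|].
  apply/eqP => AT; have := simplex_mx_sum u.
  rewrite (eq_bigr (fun=> 1)) => [|i _].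
    by rewrite sumr_const card_ord => /eqP; rewrite pnatr_eq0.
  by have := Au i; rewrite AT !inE => /(_ isT) /eqP.
rewrite -finset.properT => /fintype.properP [_ [i0 _ i0A]].
have [|u uE] := @simplex_mx_surj d (fun i => if i == i0 then - d%:R else 1).
  rewrite (bigD1 i0) //= eqxx (eq_bigr (fun=> 1)) => [|i /negbTE -> //].
  rewrite sumr_const (_ : #|_| = d) ?addNr //.
  have := cardC1 i0; rewrite card_ord => /= E.
  by rewrite -[RHS]E; apply: eq_card => i; rewrite !inE.
exists u => [i|]; rewrite ?uE.
  by case: ifP => // _; apply: le_trans (_ : 0 <= _); rewrite ?ler01 ?oppr_le0.
apply/fintype.subsetP => i iA; rewrite inE uE.
by have [ii|//] := eqVneq i i0; rewrite -ii iA in i0A.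
Qed.

Lemma simplex_irredundant d : (0 < d)%N -> irredundant (simplex_mx d).
Proof.
move=> d0 i; have dn0 : d%:R != 0 :> R by rewrite pnatr_eq0 -lt0n.
(* The value 1 at [i] is balanced by [- 1 / d] at the [d] other indices. For [d = 0] the only
   constraint is [0 <= 1], which is redundant. *)
have [|u uE] := @simplex_mx_surj d (fun j => if j == i then 1 else - d%:R^-1).
  rewrite (bigD1 i) //= eqxx (eq_bigr (fun=> - d%:R^-1)) => [|j /negbTE -> //].
  rewrite sumr_const (_ : #|_| = d);
    first by rewrite mulNrn -[_^-1 *+ d]mulr_natr mulVf // subrr.
  have := cardC1 i; rewrite card_ord => /= E.
  by rewrite -[RHS]E; apply: eq_card => j; rewrite !inE.
exists u => [|j ji]; rewrite uE ?eqxx // (negbTE ji).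
by apply: lt_trans ltr01; rewrite oppr_lt0 invr_gt0 ltr0n.
Qed.

Lemma proper_faces_simplex (V : Type) (S : set V) d : S #= `I_d.+1 ->
  exists n (P : set 'rV[R]_n), simplex P /\
    complex_iso (proper_faces S) (dual_complex P).
Proof.
move=> Sd; exists d, (hpoly (simplex_mx d) (fun=> 1)); split.
  exact: simplex_hpoly.
have [b [b_inj bS]] : exists b : 'I_d.+1 -> V, injective b /\ S = range b.
  have [f [fun_f inj_f surj_f]] := card_set_bijP Sd.
  have [v0 _ _] := surj_f 0%N (ltn0Sn d).
  have [g [[fun_g inj_g surj_g] _ _]] := set_bij_inverse v0 (And3 fun_f inj_f
    surj_f).
  exists (fun i : 'I_d.+1 => g i); split.
    by move=> i j gij; apply/ord_inj/inj_g; rewrite ?inE //=.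
  apply/seteqP; split=> [s /surj_g [i ilt <-]|_ [i _ <-]].
    by exists (Ordinal ilt).
  exact: fun_g (ltn_ord i).
have vsub : vertices (proper_faces S) `<=` S by move=> s [h _]; exact: h.
(* For [d = 0] the simplex is a point without facets, and the only proper face of the singleton [S]
   is empty. *)
have [d0|d0] := posnP d.
  have pt : is_point (hpoly (simplex_mx d) (fun=> 1)).
    move: Sd b bS b_inj; rewrite d0 => _ _ _ _.
    exists 0; apply/seteqP; split=> [x _|_ ->]; last exact: Q0.
    by apply/rowP => -[].
  have vS : vertices (proper_faces S) = set0.
    apply/seteqP; split=> // s vs; have [_] := vs; apply.
    apply/seteqP; split=> [_ ->|]; first exact: vsub.
    have := vsub _ vs; rewrite bS => -[i _ <-] _ [j _ <-]; congr b.
    by clear -d0; move: i j; rewrite d0 => i j; rewrite !ord1.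
  exists (fun=> set0); rewrite vS vertices_dual; split.
    by split=> [s []|s t|F FF]; [rewrite inE|case: (point_no_facet pt FF)].
  move=> I; rewrite subset0 => ->; rewrite image_set0; split=> _.
    by apply: dual_complex0; exists 0; exact: Q0.
  split=> [? []|S0]; have : S (b ord0) by (rewrite bS; exists ord0).
  by rewrite -S0.
have pres := presents_hpoly (simplex_irredundant d0).
pose g i := cell (simplex_mx d) 0 1%:M [set i]%SET.
have /choice [f fP] s : exists F, forall i, b i = s -> F = g i.
  have [[i <-]|ns] := EM (exists i, b i = s);
    first by exists (g i) => j /b_inj ->.
  by exists set0 => i bi; case: ns; exists i.
have fb i : f (b i) = g i by exact: fP.
have vS : vertices (proper_faces S) = S.
  apply/seteqP; split=> // s Ss; split=> [_ -> //|sS].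
  have b1 j : b j = s by have Sb : S (b j); [rewrite bS;
    exists j|rewrite -sS in Sb].
  have : (1 < d.+1)%N by [].
  by move=> d1; have /b_inj /eqP : b (Ordinal d1) = b ord0 by rewrite !b1.
exists f; rewrite vS vertices_dual bS; split.
  split=> [_ [i _ <-]|s t /[!inE] -[i _ <-] [j _ <-]|F /(facet_cell pres) [i
    ->]].
  - by apply/(facet_cell pres); exists i; rewrite fb.
  - by rewrite !fb => /(cell1_inj pres) ->.
  - by exists (b i); [exists i|exact: fb].
move=> I IS; pose A := [set i | `[< I (b i) >]]%SET.
have IA : I = b @` [set i | i \in A].
  apply/seteqP; split=> [s Is|_ [i + <-]];
    last by rewrite /mkset inE => /asboolP.
  by have [i _ bi] := IS _ Is; exists i => //; rewrite /mkset inE bi;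
    apply/asboolP.
have -> : f @` I = g @` [set i | i \in A].
  by rewrite {1}IA image_comp; apply: eq_imagel => i _ /=; exact: fb.
rewrite (dual_complex_cells _ pres) simplex_active; split=> [[_ IneS]|AT].
  apply/eqP => AT; apply: IneS; apply/seteqP; split=> // _ [i _ <-].
  have iA : i \in A by rewrite AT inE.
  by move: iA; rewrite inE => /asboolP.
split=> // IE; case/eqP: AT; apply/setP => i; rewrite !inE.
by apply/asboolP; rewrite IE; exists i.
Qed.

End StandardSimplex.

(** * Facets of a nestohedron *)

Lemma facet_cap_set1 (R : realFieldType) n (K G : set 'rV[R]_n) :
  facet K G -> facet_cap K [set G] = G.
Proof.
move=> [fG _ _]; rewrite /facet_cap bigcap_set1.
by apply/setIidr; exact: face_sub fG.
Qed.

Theorem theorem2p3p13 (R : realType) (n : nat) (P : set 'rV[R]_n)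
    (B : set (set (set 'rV[R]_n))) (m : nat) (K : set 'rV[R]_m)
    (hP : simple_polyhedron P)
    (hB : building_set (dual_complex P) B)
    (hK : nestohedron P B K) :
  forall G : set 'rV[R]_m, facet K G ->
    exists F : set 'rV[R]_n, [/\ face P F, F !=set0 &
      exists (m1 : nat) (K1 : set 'rV[R]_m1) (m2 : nat) (K2 : set 'rV[R]_m2),
        [/\ face_nestohedron F K1,
            simplex_nestohedron K2
          & comb_iso G (polyhedron_prod K1 K2)]].
Proof.
move=> G KG; have [simpleK [f []]] := hK.
rewrite vertices_dual vertices_nested => f_bij fE.
set S := f G; have BS : B S by case: f_bij => + _ _; apply.
have [BD _ _ _] := hB; have DS := BD _ BS.
have dual_vertices n' (Q : set 'rV[R]_n') I :
    dual_complex Q I -> I `<=` vertices (dual_complex Q).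
  by rewrite vertices_dual => -[].
have nested_vertices N : nested_complex (dual_complex P) B N ->
    N `<=` vertices (nested_complex (dual_complex P) B).
  by rewrite vertices_nested => -[].
have Dsub := @dual_complex_sub _ _ P.
(* The dual complex of [G] is the link of the vertex [G] in the dual complex of [K], and [f] carries
   this link to that of [S]. *)
have linkK : complex_iso (link (dual_complex K) [set G])
    (link (nested_complex (dual_complex P) B) [set S]).
  apply: (@link_set1_iso _ _ _ _ (@dual_vertices _ K) nested_vertices f G).
  - by rewrite vertices_dual vertices_nested.
  - by rewrite vertices_dual.
  - by rewrite vertices_dual.
have DG := facet_dual KG; have simpleG := simple_facet_cap simpleK DG.
have dualG := link_facet_cap simpleK DG.
rewrite facet_cap_set1 // in simpleG dualG.
have isoG := complex_iso_trans (complex_iso_sym set0 dualG)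
  (complex_iso_trans linkK (link_nested_complex Dsub hB BS)).
have G0 : G !=set0 by case: KG.
have [m1 [K1 [m2 [K2 [[simple1 iso1] [simple2 iso2] pt GK]]]]] :=
  join_iso_decomposition set0 set0 simpleG G0 isoG.
exists (facet_cap P S); split; first exact: facet_cap_face.
  exact: facet_cap_neq0.
exists m1, K1, m2, K2; split=> //.
  have linkF := link_facet_cap hP DS.
  have [|C buildC isoC] := nested_complex_iso _
    (building_contraction S Dsub hB) linkF.
    move=> I [IS DIS] s Is; split.
      apply/seteqP; split=> // t [-> Ss].
      by have : (I `&` S) s by []; rewrite IS.
    by apply: Dsub DIS _ => t [->|]; [left|right].
  by exists C; split=> //; split=> //; exact: complex_iso_trans isoC.
have [k Sk _] := affdim_facet_cap hP DS.
(* Elements of a building set are nonempty, so the size of [S] can be written [d.+1], the number of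
   facets of a [d]-simplex for [d > 0]. *)
case: k Sk => [|d] Sd.
  have [s Ss] := building_neq0 hB BS.
  by move: Sd; rewrite II0 card_eq0 => /eqP S0; rewrite S0 in Ss.
have [q [D [simplexD isoD]]] := proper_faces_simplex R Sd.
have proper_sub I J : proper_faces S I -> J `<=` I -> proper_faces S J.
  move=> [IS nIS] JI; split; first exact: subset_trans IS.
  by move=> JS; apply: nIS; apply/seteqP; split=> //; rewrite -JS.
have proper_vertices I : proper_faces S I -> I `<=` vertices (proper_faces S).
  by move=> SI s Is; apply: (proper_sub I) => // _ ->.
have [|C buildC isoC] := nested_complex_iso _
  (building_restriction Dsub hB BS) isoD.
  exact: proper_vertices.
exists q, D, C; split=> //.
  by split=> //; exact: complex_iso_trans isoC.
(* If [D] is a point, it has no facets, so the boundary of [S] has no vertices and [restriction] is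
   empty; hence [K2] is a point. *)
move=> ptD; apply: pt => X [+ _] => /(_ X erefl) [BX SX].
have [s Xs] := building_neq0 hB BX.
have [g [[fun_g _ _] _]] := isoD.
apply: (point_no_facet ptD (F := g s)); rewrite -vertices_dual.
apply: fun_g; exact: proper_vertices SX _ Xs.
Qed.
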